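(* Let $\mathcal{P}$ be a graph property and suppose that the input-restricted maximal $\mathcal{P}$-subgraphs problem can be solved in polynomial time (in the number of vertices of the input). Then: (1) if $\mathcal{P}$ is rooted-hereditary, the maximal $\mathcal{P}$-subgraphs problem restricted to acyclic input graphs $G$ is P-enumerable; and (2) if $\mathcal{P}$ is connected-hereditary, the maximal $\mathcal{P}$-subgraphs problem restricted to input graphs $G$ whose underlying undirected graph is a tree is P-enumerable.
   Context: A graph is a triple $G=(V,E,r)$ with $V$ a finite set of vertices, $E\subseteq V\times V$ a set of (directed) edges, and a root $r\in V\cup\{\bot\}$. $G$ is rooted if $r\neq\bot$ and every vertex is reachable from $r$ by a directed path; $G$ is connected if its underlying undirected graph is connected; $G$ is acyclic if it has no directed cycle. $H$ is an induced subgraph of $G$, written $H\subseteq_{\mathrm{IS}} G$, if $H$ is obtained from $G$ by deleting some vertices (and incident edges), and the root of $H$ equals the root of $G$ if that root is still a vertex of $H$, and is $\bot$ otherwise; $H\subset_{\mathrm{IS}}G$ means additionally $H\neq G$. $G-v$ is the induced subgraph on all vertices other than $v$. A graph property is a nonempty (possibly infinite) set $\mathcal{P}$ of graphs; throughout, membership in $\mathcal{P}$ is decidable in polynomial time. $\mathcal{P}$ is connected-hereditary if all its graphs are connected and every connected induced subgraph of a graph in $\mathcal{P}$ is in $\mathcal{P}$; it is rooted-hereditary if all its graphs are rooted and every rooted induced subgraph of a graph in $\mathcal{P}$ is in $\mathcal{P}$. A $\mathcal{P}$-subgraph of $G$ is an $H\subseteq_{\mathrm{IS}}G$ with $H\in\mathcal{P}$;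 it is maximal if no $\mathcal{P}$-subgraph $H'$ of $G$ has $H\subset_{\mathrm{IS}}H'$; $\mathcal{P}^m(G)$ is the set of maximal $\mathcal{P}$-subgraphs. $G$ almost satisfies $\mathcal{P}$ if $G-v\in\mathcal{P}$ for some vertex $v$. The maximal $\mathcal{P}$-subgraphs problem: given $G$, output $\mathcal{P}^m(G)$. The input-restricted version: given $G$ almost satisfying $\mathcal{P}$, output $\mathcal{P}^m(G)$. A problem is P-enumerable if all outputs can be listed in time at most $K\cdot p(n)$ for a polynomial $p$, where $n$ is the number of vertices of the input and $K$ the number of graphs in the output.
   Formalization: The time bound K·p(n) is replaced by max(1,K)·p(n), because K = 0 can occur (for instance a rooted-hereditary property and an input graph without a root) and no algorithm runs in zero steps. *)

(* Defs.v *)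
From Stdlib Require List.
From HB Require Import structures.
From mathcomp Require Import all_boot all_order all_algebra finmap.

Set Implicit Arguments.
Unset Strict Implicit.
Unset Printing Implicit Defensive.

Local Open Scope fset_scope.

(* Vertices are named by natural numbers, so that every finite graph has a
   copy here and equality of graphs is equality of the triples (V, E, r).
   [None] is the absent root. *)

Definition graph_triple : Type :=
  ({fset nat} * {fset nat * nat} * option nat)%type.

Definition wf_triple (t : graph_triple) : bool :=
  let: (V, E, r) := t in
  (E `<=` V `*` V) && (if r is Some x then x \in V else true).

Record graph := Graph {
  triple_of :> graph_triple;
  triple_of_wf : wf_triple triple_of }.

HB.instance Definition _ := [isSub for triple_of].
HB.instance Definition _ := [Choice of graph by <:].

Definition verts (G : graph) : {fset nat} := (triple_of G).1.1.
Definition edges (G : graph) : {fset nat * nat} := (triple_of G).1.2.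
Definition groot (G : graph) : option nat := (triple_of G).2.

Definition nverts (G : graph) : nat := #|` verts G|.

Definition edge (G : graph) : rel nat := fun u v => (u, v) \in edges G.

Definition adj (G : graph) : rel nat := fun u v => edge G u v || edge G v u.

Definition rooted (G : graph) : Prop :=
  exists2 r, groot G = Some r &
    forall v, v \in verts G -> exists2 p, path (edge G) r p & last r p = v.

(* Vacuously true of the graph without vertices. *)
Definition connected (G : graph) : Prop :=
  forall u v, u \in verts G -> v \in verts G ->
    exists2 p, path (adj G) u p & last u p = v.

Definition acyclic (G : graph) : Prop :=
  forall c, c != [::] -> ~~ cycle (edge G) c.

(* The underlying undirected graph identifies (u, v) with (v, u), so its
   cycles have either length one (a loop) or at least three vertices. *)
Definition underlying_tree (G : graph) : Prop :=
  [/\ connected G,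
      forall v, ~~ adj G v v &
      forall c, 2 < size c -> ~ ucycle (adj G) c].

Definition induced_triple (G : graph) (S : {fset nat}) : graph_triple :=
  (verts G `&` S,
   [fset e in edges G | (e.1 \in S) && (e.2 \in S)],
   if groot G is Some x then if x \in S then Some x else None else None).

Lemma induced_triple_wf (G : graph) (S : {fset nat}) :
  wf_triple (induced_triple G S).
Proof.
rewrite /induced_triple /verts /edges /groot.
case: G => [[[V E] r] wfG] /=; case/andP: wfG => sEV rV; apply/andP; split.
  apply/fsubsetP => -[u v]; rewrite !inE /= => /andP[/(fsubsetP sEV)].
  by rewrite !inE /= => /andP[-> ->] /andP[-> ->].
case: r rV => [x|] //= xV.
by case: ifP => // xS; rewrite inE xV xS.
Qed.

Definition induced (G : graph) (S : {fset nat}) : graph :=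
  Graph (induced_triple_wf G S).

Definition sub_IS (H G : graph) : Prop :=
  exists2 S : {fset nat}, S `<=` verts G & H = induced G S.

Definition proper_IS (H G : graph) : Prop := sub_IS H G /\ H <> G.

Definition del_vertex (G : graph) (v : nat) : graph :=
  induced G (verts G `\ v).

Definition connected_hereditary (P : graph -> Prop) : Prop :=
  (forall G, P G -> connected G) /\
  (forall G H, P G -> sub_IS H G -> connected H -> P H).

Definition rooted_hereditary (P : graph -> Prop) : Prop :=
  (forall G, P G -> rooted G) /\
  (forall G H, P G -> sub_IS H G -> rooted H -> P H).

Definition P_subgraph (P : graph -> Prop) (G H : graph) : Prop :=
  sub_IS H G /\ P H.

Definition maximal_P_subgraph (P : graph -> Prop) (G H : graph) : Prop :=
  P_subgraph P G H /\ forall H', P_subgraph P G H' -> ~ proper_IS H H'.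

Definition almost_satisfies (P : graph -> Prop) (G : graph) : Prop :=
  exists2 v, v \in verts G & P (del_vertex G v).

(* A structured pointer machine, in the style of Jones' WHILE language: data
   are binary trees with natural numbers at the leaves, handled by reference,
   and every executed instruction has unit cost. Vertex names occupy a single
   leaf, which is why time can be measured in the number of vertices. Numbers
   are only added and subtracted, so a step lengthens them by at most one bit
   and the model is polynomially equivalent to Turing machines. *)

Inductive data := Leaf of nat | Node of data & data.

Inductive prim :=
  | Const of nat
  | Fst | Snd
  | IsNode
  | Add | Sub.     (* on a node of two leaves; [Sub] is truncated *)

Definition eval_prim (o : prim) (x : data) : data :=
  match o, x with
  | Const n, _ => Leaf n
  | Fst, Node a _ => a
  | Snd, Node _ b => b
  | IsNode, Node _ _ => Leaf 1
  | Add, Node (Leaf m) (Leaf n) => Leaf (m + n)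
  | Sub, Node (Leaf m) (Leaf n) => Leaf (m - n)
  | _, _ => Leaf 0
  end.

(* [Leaf 0] is false (and the empty list); all other data are true. *)
Definition truthy (x : data) : bool := if x is Leaf 0 then false else true.

Inductive prog :=
  | Skip
  | Prim of prim
  | Seq of prog & prog
  | Fork of prog & prog           (* both on the same input, paired *)
  | If of prog & prog & prog      (* test, then-branch, else-branch *)
  | While of prog & prog.         (* test, body *)

(* [run p x y t]: on input [x], [p] halts with output [y] after [t] steps. *)
Inductive run : prog -> data -> data -> nat -> Prop :=
  | run_skip x : run Skip x x 1
  | run_prim o x : run (Prim o) x (eval_prim o x) 1
  | run_seq p q x y z s t :
      run p x y s -> run q y z t -> run (Seq p q) x z (s + t).+1
  | run_fork p q x y z s t :
      run p x y s -> run q x z t -> run (Fork p q) x (Node y z) (s + t).+1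
  | run_if_true c p q x b y s t :
      run c x b s -> truthy b -> run p x y t -> run (If c p q) x y (s + t).+1
  | run_if_false c p q x b y s t :
      run c x b s -> ~~ truthy b -> run q x y t ->
      run (If c p q) x y (s + t).+1
  | run_while_stop c p x b s :
      run c x b s -> ~~ truthy b -> run (While c p) x x s.+1
  | run_while_step c p x b y z s t u :
      run c x b s -> truthy b -> run p x y t -> run (While c p) y z u ->
      run (While c p) x z (s + t + u).+1.

Lemma run_functional p x y t y' t' :
  run p x y t -> run p x y' t' -> y = y' /\ t = t'.
Proof.
move=> r; elim: r y' t' => {p x y t}; intros;
  match goal with H : run _ _ y' t' |- _ => inversion H; subst end;
  repeat match goal with
  | IH : forall y t, run ?p ?x y t -> _, H : run ?p ?x _ _ |- _ =>
      case: (IH _ _ H) => ? ?; clear H; subst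
  | H : is_true (~~ ?b), H' : is_true ?b |- _ => by rewrite H' in H
  end; by [].
Qed.

Definition code_seq (s : seq data) : data := foldr Node (Leaf 0) s.

Definition code_edge (e : nat * nat) : data := Node (Leaf e.1) (Leaf e.2).

Definition code_root (r : option nat) : data :=
  if r is Some x then Node (Leaf x) (Leaf 0) else Leaf 0.

(* A graph has several codes: its vertices and its edges may be listed in any
   order, without repetition. *)
Definition codes (d : data) (G : graph) : Prop :=
  exists vs es,
    [/\ uniq vs, vs =i verts G, uniq es, es =i edges G &
        d = Node (code_seq (map Leaf vs))
                 (Node (code_seq (map code_edge es)) (code_root (groot G)))].

(* [d] lists, without repetition, exactly the graphs satisfying [Q]; there are
   [K] of them. *)
Definition lists (d : data) (Q : graph -> Prop) (K : nat) : Prop :=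
  exists (ds : seq data) (Hs : seq graph),
    [/\ d = code_seq ds, List.Forall2 codes ds Hs, uniq Hs,
        (forall H, H \in Hs <-> Q H) & size Hs = K].

Definition ptime_decidable (P : graph -> Prop) : Prop :=
  exists (a : prog) (p : {poly nat}), forall (G : graph) (d : data),
    codes d G ->
    exists (b : data) (t : nat),
      [/\ run a d b t, truthy b <-> P G & t <= (p.[nverts G])%R].

Definition graph_property (P : graph -> Prop) : Prop :=
  (exists G, P G) /\ ptime_decidable P.

Definition input_restricted_ptime (P : graph -> Prop) : Prop :=
  exists (a : prog) (p : {poly nat}), forall (G : graph) (d : data),
    almost_satisfies P G -> codes d G ->
    exists (out : data) (K t : nat),
      [/\ run a d out t, lists out (maximal_P_subgraph P G) K &
          t <= (p.[nverts G])%R].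

(* The maximal P-subgraphs problem on the inputs satisfying [D]. The factor is
   [maxn 1 K] because [K] may be zero (take P rooted-hereditary and G without
   root), while every program takes at least one step. *)
Definition P_enumerable_on (D P : graph -> Prop) : Prop :=
  exists (a : prog) (p : {poly nat}), forall (G : graph) (d : data),
    D G -> codes d G ->
    exists (out : data) (K t : nat),
      [/\ run a d out t, lists out (maximal_P_subgraph P G) K &
          t <= maxn 1 K * (p.[nverts G])%R].

(* Main.v *)
From mathcomp Require Import all_boot all_order all_algebra finmap.
From mathcomp Require Import boolp zify.
Require Import Defs.

(** Insert the vertices one at a time: in the rooted case the root first and
    then in topological order, in the tree case each vertex next to an earlier
    one. A newly inserted vertex [v] can be deleted from any P-subgraph of the
    current prefix [U + v] without leaving P (it is a sink, respectively a leaf).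
    Hence every maximal P-subgraph [H] of [U] is [C - v] for some maximal
    P-subgraph [C] of [U + v], so the number of maximal P-subgraphs never
    decreases along the way and is bounded by the final count. Conversely, if
    [C] is maximal in [U + v] and [H] is maximal in [U] with [C - v] contained
    in [H], then [C] is a maximal P-subgraph of [H + v], a graph that almost
    satisfies P, so the input-restricted algorithm finds it from [H].
    Duplicates are avoided without comparing outputs: [C] is accepted only from
    its canonical parent, the greedy extension of [C - v] in [U]. Greedy
    extension by single vertices reaches maximal sets because a P-subgraph
    properly contained in another can be enlarged by one vertex of it. *)

Set Implicit Arguments.
Unset Strict Implicit.
Unset Printing Implicit Defensive.

(** * Programs with environments, and their running time *)

(** Costs are bounded only from above, so they can be rounded up and stated uniformly in a size
    bound [N]. *)
Definition ev (p : prog) (x y : data) (B : nat) : Prop :=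
  exists2 t, run p x y t & t <= B.

Lemma ev_le p x y B B' : ev p x y B -> B <= B' -> ev p x y B'.
Proof. by case=> t r le_t le_B; exists t => //; apply: leq_trans le_B. Qed.

Lemma ev_skip x : ev Skip x x 1.
Proof. by exists 1 => //; constructor. Qed.

Lemma ev_prim o x y : eval_prim o x = y -> ev (Prim o) x y 1.
Proof. by move=> <-; exists 1 => //; constructor. Qed.

Lemma ev_seq p q x y z B C :
  ev p x y B -> ev q y z C -> ev (Seq p q) x z (B + C).+1.
Proof.
by move=> [s rp le_s] [t rq le_t]; exists (s + t).+1; [apply: run_seq rp rq | lia].
Qed.

Lemma ev_fork p q x y z B C :
  ev p x y B -> ev q x z C -> ev (Fork p q) x (Node y z) (B + C).+1.
Proof.
by move=> [s rp le_s] [t rq le_t]; exists (s + t).+1; [apply: run_fork rp rq | lia].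
Qed.

(** The bounds of both branches are added, so one bound serves either outcome of the test. A branch
    known not to be taken can be given the bound 0, its premise being vacuous. *)
Lemma ev_if c p q x b y A B C :
  ev c x b A -> (truthy b -> ev p x y B) -> (~~ truthy b -> ev q x y C) ->
  ev (If c p q) x y (A + B + C).+1.
Proof.
move=> [s rc le_s] Hp Hq; have [tb|tb] := boolP (truthy b).
  case: (Hp tb) => t rp le_t.
  by exists (s + t).+1; [apply: run_if_true rc tb rp | lia].
case: (Hq tb) => t rq le_t.
by exists (s + t).+1; [apply: run_if_false rc tb rq | lia].
Qed.

(* An environment is a right-nested list of values, the innermost binding first. *)
Fixpoint Var (i : nat) : prog :=
  if i is j.+1 then Seq (Prim Snd) (Var j) else Prim Fst.

Fixpoint lookup (i : nat) (x : data) : data :=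
  if i is j.+1 then lookup j (eval_prim Snd x) else eval_prim Fst x.

Lemma ev_var i x y : lookup i x = y -> ev (Var i) x y i.*2.+1.
Proof.
elim: i x => [|i IH] x e; first exact: ev_prim.
apply: (@ev_le _ _ _ (1 + i.*2.+1).+1); last by lia.
by apply: ev_seq (IH _ e); apply: ev_prim.
Qed.

(** The callee runs in a fresh environment holding only its arguments, so its variable indices do
    not depend on the caller. *)
Definition Call (f : prog) (args : seq prog) : prog :=
  Seq (foldr Fork (Prim (Const 0)) args) f.

Lemma ev_call2 f p1 p2 x y1 y2 z B1 B2 B :
  ev p1 x y1 B1 -> ev p2 x y2 B2 -> ev f (code_seq [:: y1; y2]) z B ->
  ev (Call f [:: p1; p2]) x z (B1 + B2 + B + 4).
Proof.
move=> e1 e2 ef; apply: ev_le (ev_seq (ev_fork e1 (ev_fork e2 _)) ef) _.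
  exact: ev_prim.
by lia.
Qed.

Lemma ev_call3 f p1 p2 p3 x y1 y2 y3 z B1 B2 B3 B :
  ev p1 x y1 B1 -> ev p2 x y2 B2 -> ev p3 x y3 B3 ->
  ev f (code_seq [:: y1; y2; y3]) z B ->
  ev (Call f [:: p1; p2; p3]) x z (B1 + B2 + B3 + B + 5).
Proof.
move=> e1 e2 e3 ef.
apply: ev_le (ev_seq (ev_fork e1 (ev_fork e2 (ev_fork e3 _))) ef) _.
  exact: ev_prim.
by lia.
Qed.

Lemma ev_call4 f p1 p2 p3 p4 x y1 y2 y3 y4 z B1 B2 B3 B4 B :
  ev p1 x y1 B1 -> ev p2 x y2 B2 -> ev p3 x y3 B3 -> ev p4 x y4 B4 ->
  ev f (code_seq [:: y1; y2; y3; y4]) z B ->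
  ev (Call f [:: p1; p2; p3; p4]) x z (B1 + B2 + B3 + B4 + B + 6).
Proof.
move=> e1 e2 e3 e4 ef.
apply: ev_le
  (ev_seq (ev_fork e1 (ev_fork e2 (ev_fork e3 (ev_fork e4 _)))) ef) _.
  exact: ev_prim.
by lia.
Qed.

Lemma ev_call5 f p1 p2 p3 p4 p5 x y1 y2 y3 y4 y5 z B1 B2 B3 B4 B5 B :
  ev p1 x y1 B1 -> ev p2 x y2 B2 -> ev p3 x y3 B3 -> ev p4 x y4 B4 ->
  ev p5 x y5 B5 -> ev f (code_seq [:: y1; y2; y3; y4; y5]) z B ->
  ev (Call f [:: p1; p2; p3; p4; p5]) x z (B1 + B2 + B3 + B4 + B5 + B + 7).
Proof.
move=> e1 e2 e3 e4 e5 ef.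
apply: ev_le (ev_seq
  (ev_fork e1 (ev_fork e2 (ev_fork e3 (ev_fork e4 (ev_fork e5 _))))) ef) _.
  exact: ev_prim.
by lia.
Qed.

(* The loop state is [Node l (Node acc env)]; the body sees the current list
   element as [Var 0], the accumulator as [Var 1], then the environment. *)
Definition Fold (el ei body : prog) : prog :=
  Seq (Fork el (Fork ei Skip))
    (Seq (While (Prim Fst)
            (Fork (Seq (Prim Fst) (Prim Snd))
               (Fork (Seq (Fork (Seq (Prim Fst) (Prim Fst)) (Prim Snd)) body)
                  (Seq (Prim Snd) (Prim Snd)))))
       (Seq (Prim Snd) (Prim Fst))).

(** [Inv p s] ties the consumed prefix [p] to the accumulator [s]. It is a relation, so the
    accumulator may be specified up to the order of a list. Each step also learns where its element
    sits in [ys], which yields membership and distinctness. *)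
Lemma ev_fold (X Y : Type) (cy : Y -> data) (cx : X -> data)
    (Inv : seq Y -> X -> Prop) env el ei body ys s0 N B Bl Bi :
  ev el env (code_seq (map cy ys)) Bl -> ev ei env (cx s0) Bi ->
  size ys <= N -> Inv [::] s0 ->
  (forall p y q s, ys = p ++ y :: q -> Inv p s ->
    exists2 s', Inv (rcons p y) s' &
      ev body (Node (cy y) (Node (cx s) env)) (cx s') B) ->
  exists2 s, Inv ys s & ev (Fold el ei body) env (cx s) (Bl + Bi + N * (B + 20) + 20).
Proof.
move=> evl evi leN Inv0 step.
suff loop p q s : ys = p ++ q -> Inv p s ->
    exists2 s', Inv ys s' &
      ev (While (Prim Fst)
            (Fork (Seq (Prim Fst) (Prim Snd))
               (Fork (Seq (Fork (Seq (Prim Fst) (Prim Fst)) (Prim Snd)) body)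
                  (Seq (Prim Snd) (Prim Snd)))))
        (Node (code_seq (map cy q)) (Node (cx s) env))
        (Node (Leaf 0) (Node (cx s') env)) (size q * (B + 20) + 2).
  have [s' Inv' evw] := loop [::] ys s0 (erefl _) Inv0.
  exists s' => //.
  have fin : ev (Seq (Prim Snd) (Prim Fst)) (Node (Leaf 0) (Node (cx s') env)) (cx s') (1 + 1).+1.
    by apply: ev_seq; apply: ev_prim.
  apply: ev_le (ev_seq (ev_fork evl (ev_fork evi (ev_skip _))) (ev_seq evw fin)) _.
  by have := leq_mul leN (leqnn (B + 20)); lia.
elim: q p s => [|y q IH] p s def_ys Invp.
  rewrite cats0 in def_ys; subst p; exists s => //; exists 2 => //=.
  by apply: (@run_while_stop _ _ _ (Leaf 0)) => //; apply: (run_prim Fst).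
have [s1 Inv1 [t rb le_t]] := step _ _ _ _ def_ys Invp.
have [|s' Inv' [u rw le_u]] := IH (rcons p y) s1 _ Inv1; first by rewrite cat_rcons.
exists s' => //.
eexists.
  apply: run_while_step; [exact: (run_prim Fst)|by []| |exact: rw].
  apply: run_fork.
    by apply: run_seq; [apply: (run_prim Fst)|apply: (run_prim Snd)].
  apply: run_fork; last first.
    by apply: run_seq; [apply: (run_prim Snd)|apply: (run_prim Snd)].
  apply: run_seq; last exact: rb.
  apply: run_fork; last exact: (run_prim Snd).
  by apply: run_seq; [apply: (run_prim Fst)|apply: (run_prim Fst)].
rewrite /= mulSn; lia.
Qed.

(* The environment is [ws], the initial state, then anything; [tst] and [upd]
   see the candidate [w] as [Var 0], the state as [Var 1] and that remainder
   from [Var 6] on. As many passes as [ws] has elements reach a state where no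
   candidate passes the test. *)
Definition Close (tst upd : prog) : prog :=
  Fold (Var 0) (Var 1) (Fold (Var 2) (Var 1) (If tst upd (Var 1))).

Definition code_nats (s : seq nat) : data := code_seq (map Leaf s).

(** [pr] lists the elements inserted so far, so at most [size ws] insertions can happen. [x1] to
    [x4] are the bindings left by the outer fold and the environment; the test and the update must
    work for any values of them. *)
Lemma ev_close (X : Type) (cx : X -> data) (pr : X -> seq nat)
    (adm : X -> nat -> Prop) (Inv : X -> Prop) ws s0 rest tst upd N B :
  size ws <= N -> Inv s0 ->
  (forall s, Inv s -> uniq (pr s) /\ {subset pr s <= ws}) ->
  (forall s w, adm s w -> w \notin pr s) ->
  (forall w s x1 x2 x3 x4, w \in ws -> Inv s -> exists2 b, truthy b <-> adm s w &
    ev tst (Node (Leaf w) (Node (cx s) (Node x1 (Node x2 (Node x3 (Node x4 rest)))))) b B) ->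
  (forall w s x1 x2 x3 x4, w \in ws -> Inv s -> adm s w -> exists s',
    [/\ Inv s', pr s' = w :: pr s &
    ev upd (Node (Leaf w) (Node (cx s) (Node x1 (Node x2 (Node x3 (Node x4 rest))))))
      (cx s') B]) ->
  exists s, [/\ Inv s, forall w, w \in ws -> ~ adm s w &
    ev (Close tst upd) (Node (code_nats ws) (Node (cx s0) rest)) (cx s)
      (N * (N * (2 * B + 30) + 60) + 30)].
Proof.
move=> leN Inv0 InvP admP evt evu.
pose env := Node (code_nats ws) (Node (cx s0) rest).
(* After the passes [p], either the state is saturated or it has gained at least one element per
   pass. *)
pose OInv (p : seq nat) s :=
  Inv s /\ ((forall w, w \in ws -> ~ adm s w) \/ size p <= size (pr s)).
have [] := @ev_fold X nat Leaf cx OInv env (Var 0) (Var 1)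
   (Fold (Var 2) (Var 1) (If tst upd (Var 1))) ws s0 N
   (N * (2 * B + 30) + 40) 1 3.
- exact: ev_var.
- exact: ev_var.
- by [].
- by split=> //; right.
- move=> p y q st _ [Invst satst].
  (* Within a pass, either nothing has changed and no scanned candidate was admissible, or the state
     has grown. The second case records a candidate admissible at the start of the pass, which
     excludes that the pass began saturated. *)
  pose IInv (r : seq nat) s := Inv s /\
    ((s = st /\ forall w, w \in r -> ~ adm st w) \/
     (size (pr st) < size (pr s) /\ exists2 w, w \in ws & adm st w)).
  have [] := @ev_fold X nat Leaf cx IInv (Node (Leaf y) (Node (cx st) env))
    (Var 2) (Var 1) (If tst upd (Var 1)) ws st N (2 * B + 10) 5 3.
  + exact: ev_var.
  + exact: ev_var.
  + by [].
  + by split=> //; left.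
  + move=> r w r' s def_ws [Invs IHs].
    have w_ws : w \in ws by rewrite def_ws mem_cat mem_head orbT.
    have [b' bP' evb] := evt w s (Leaf y) (cx st) (code_nats ws) (cx s0) w_ws Invs.
    have [a|na] := pselect (adm s w).
      have [s' [Invs' prs' ev']] :=
        evu w s (Leaf y) (cx st) (code_nats ws) (cx s0) w_ws Invs a.
      exists s'.
        split=> //; right; case: IHs => [[es _]|[lt ex]].
          by split; [rewrite prs' es | exists w; rewrite -?es].
        by split=> //; rewrite prs' /=; lia.
      apply: ev_le (@ev_if _ _ _ _ b' _ B B 0 evb _ _) _ => //; last by lia.
      by move/negP; case; apply/bP'.
    exists s.
      split=> //; case: IHs => [[es nadm]|]; [left|by right].
      split=> // w'; rewrite mem_rcons inE => /orP[/eqP->|]; first by rewrite -es.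
      exact: nadm.
    apply: ev_le (@ev_if _ _ _ _ b' _ B 0 3 evb _ _) _ => //; last by lia.
      by move/bP'.
    by move=> _; apply: ev_var.
  move=> s' [Invs' Hs'] ev'; exists s'; last first.
    by apply: ev_le ev' _; nia.
  split=> //; case: Hs' => [[-> nadm]|[lt [w w_ws aw]]]; first by left.
  case: satst => [sat|le]; first by case: (sat w).
  by right; rewrite size_rcons; lia.
move=> s [Invs sat] evs; exists s; split=> //; last by apply: ev_le evs _; nia.
(* After [size ws] passes without saturation, [pr s] is a duplicate-free list inside [ws] of full
   length, so no candidate is left outside it. *)
case: sat => // le w w_ws /admP; rewrite -[_ \notin _]/(~~ _) => /negP; apply.
have [u sub] := InvP s Invs.
by rewrite (uniq_min_size u sub le).2.
Qed.

(** * Output size against running time *)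

Fixpoint height (x : data) : nat :=
  if x is Node a b then (maxn (height a) (height b)).+1 else 0.

(** The height of a value grows by at most the time spent. As a list is no longer than the height of
    its code, the running time bounds the number of items that a program can output. *)
Lemma run_height p x y t : run p x y t -> height y <= height x + t.
Proof.
elim=> {p x y t} /=; try by intros; lia.
- by case=> [n||||| ] [m|a b] //=; try lia; case: a b => [?|? ?] [?|? ?] //=; lia.
Qed.

Lemma size_le_height s : size s <= height (code_seq s).
Proof. by elim: s => //= a s; lia. Qed.

Lemma height_code_seq c s : (forall x, List.In x s -> height x <= c) ->
  height (code_seq s) <= size s + c.
Proof.
elim: s => //= a s IH H; have := H a (or_introl (erefl _)).
by have := IH (fun x i => H x (or_intror i)); lia.
Qed.

(** * Lists of vertices and induced subgraphs *)

Ltac evs := repeat first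
  [ exact: ev_skip | eapply ev_var; reflexivity | eapply ev_prim; reflexivity
  | eapply ev_seq | eapply ev_fork ].

(** The two truncated differences [a - b] and [b - a] add up to the distance of [a] and [b], which
    is zero exactly when they are equal. *)
Definition Neq (p q : prog) : prog :=
  Seq (Fork p q)
    (Seq (Fork (Prim Sub) (Seq (Fork (Prim Snd) (Prim Fst)) (Prim Sub)))
       (Prim Add)).

Lemma ev_neq p q x a b B C : ev p x (Leaf a) B -> ev q x (Leaf b) C ->
  ev (Neq p q) x (Leaf ((a - b) + (b - a))) (B + C + 12).
Proof.
by move=> ep eq; eapply ev_le; [eapply ev_seq; [exact: ev_fork ep eq | evs] | lia].
Qed.

Lemma truthy_neq a b : truthy (Leaf ((a - b) + (b - a))) = (a != b).
Proof. by rewrite /truthy; case E: ((a - b) + (b - a)) => [|k]; lia. Qed.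

Definition code_bool (b : bool) : data := Leaf b.

Lemma truthy_bool b : truthy (code_bool b) = b.
Proof. by case: b. Qed.

Definition Mem : prog :=
  Fold (Var 1) (Prim (Const 0))
    (If (Neq (Var 0) (Var 2)) (Var 1) (Prim (Const 1))).

Definition Tmem (N : nat) : nat := N * 50 + 50.

Lemma ev_mem x S N : size S <= N ->
  ev Mem (code_seq [:: Leaf x; code_nats S]) (code_bool (x \in S)) (Tmem N).
Proof.
move=> leN.
have [] := @ev_fold bool nat Leaf code_bool (fun p b => b = (x \in p))
  (code_seq [:: Leaf x; code_nats S]) (Var 1) (Prim (Const 0))
  (If (Neq (Var 0) (Var 2)) (Var 1) (Prim (Const 1))) S false N 30 3 1.
- by evs.
- by evs.
- by [].
- by [].
- move=> p y q b _ ->; exists (x \in rcons p y) => //.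
  eapply ev_le.
    apply: ev_if; first by eapply ev_neq; evs.
      rewrite truthy_neq mem_rcons inE eq_sym => /negPf ->; by evs.
    rewrite truthy_neq negbK mem_rcons inE eq_sym => ->; by evs.
  by lia.
by move=> b -> ev_b; apply: ev_le ev_b _; rewrite /Tmem; lia.
Qed.

Definition Sub_list : prog :=
  Fold (Var 0) (Prim (Const 1))
    (If (Call Mem [:: Var 0; Var 3]) (Var 1) (Prim (Const 0))).

Definition Tsub (N : nat) : nat := N * (Tmem N + 50) + 50.

Lemma ev_sub_list S U N : size S <= N -> size U <= N ->
  ev Sub_list (code_seq [:: code_nats S; code_nats U])
    (code_bool (all [in U] S)) (Tsub N).
Proof.
move=> leS leU.
have [] := @ev_fold bool nat Leaf code_bool (fun p b => b = all [in U] p)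
  (code_seq [:: code_nats S; code_nats U]) (Var 0) (Prim (Const 1))
  (If (Call Mem [:: Var 0; Var 3]) (Var 1) (Prim (Const 0)))
  S true N (Tmem N + 20) 1 1.
- by evs.
- by evs.
- by [].
- by [].
- move=> p y q b _ ->; exists (all [in U] (rcons p y)) => //.
  eapply ev_le.
    apply: ev_if; first by eapply ev_call2; [evs|evs|exact: (ev_mem y leU)].
      rewrite truthy_bool all_rcons => /= -> /=; by evs.
    rewrite truthy_bool all_rcons => /= /negPf -> /=; by evs.
  by lia.
by move=> b -> ev_b; apply: ev_le ev_b _; rewrite /Tsub; lia.
Qed.

(** It is [U] that is filtered, not [S]: the result depends on [S] only as a set. This makes the
    canonical parent of a set well defined although greedy extension works on lists. *)
Definition Restrict : prog :=
  Fold (Var 1) (Prim (Const 0))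
    (If (Call Mem [:: Var 0; Var 2]) (Fork (Var 0) (Var 1)) (Var 1)).

Lemma ev_restrict S U N : size S <= N -> size U <= N ->
  ev Restrict (code_seq [:: code_nats S; code_nats U])
    (code_nats (rev [seq x <- U | x \in S])) (Tsub N).
Proof.
move=> leS leU.
have [] := @ev_fold (seq nat) nat Leaf code_nats
  (fun p s => s = rev [seq x <- p | x \in S])
  (code_seq [:: code_nats S; code_nats U]) (Var 1) (Prim (Const 0))
  (If (Call Mem [:: Var 0; Var 2]) (Fork (Var 0) (Var 1)) (Var 1))
  U [::] N (Tmem N + 26) 3 1.
- by evs.
- by evs.
- by [].
- by [].
- move=> p y q b _ ->; exists (rev [seq x <- rcons p y | x \in S]) => //.
  eapply ev_le.
    apply: ev_if; first by eapply ev_call2; [evs|evs|exact: (ev_mem y leS)].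
      rewrite truthy_bool filter_rcons => ->; rewrite rev_rcons; by evs.
    rewrite truthy_bool filter_rcons => /negPf ->; by evs.
  by lia.
by move=> b -> ev_b; apply: ev_le ev_b _; rewrite /Tsub; lia.
Qed.

Definition graph_code (vs : seq nat) (es : seq (nat * nat)) (r : option nat) :=
  Node (code_nats vs) (Node (code_seq (map code_edge es)) (code_root r)).

Lemma size_edges G (es : seq (nat * nat)) :
  uniq es -> es =i edges G -> size es <= nverts G * nverts G.
Proof.
move=> ues eqes; rewrite /nverts -(size_allpairs pair).
apply: uniq_leq_size ues _ => -[u v]; rewrite eqes => uvE.
apply/allpairsP; exists (u, v); case: G {eqes} uvE => [[[V E] r] /= wf] uvE.
by case/andP: (wf) => /fsubsetP/(_ _ uvE); rewrite inE => /andP[].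
Qed.

Definition GV (i : nat) := Seq (Var i) (Prim Fst).
Definition GE (i : nat) := Seq (Var i) (Seq (Prim Snd) (Prim Fst)).
Definition GR (i : nat) := Seq (Var i) (Seq (Prim Snd) (Prim Snd)).

(** Environment [graph; vertex list]. The given list is reused as the vertex list of the result. *)
Definition Induced : prog :=
  Fork (Var 1)
    (Fork
      (Fold (GE 0) (Prim (Const 0))
        (If (Call Mem [:: Seq (Var 0) (Prim Fst); Var 3])
           (If (Call Mem [:: Seq (Var 0) (Prim Snd); Var 3])
              (Fork (Var 0) (Var 1)) (Var 1))
           (Var 1)))
      (If (GR 0)
         (If (Call Mem [:: Seq (GR 0) (Prim Fst); Var 1]) (GR 0) (Prim (Const 0)))
         (Prim (Const 0)))).

Definition Tind (N : nat) : nat := (N * N + 1) * (2 * Tmem N + 100) + 100.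

Lemma ev_induced d G S N : codes d G -> uniq S -> {subset S <= verts G} ->
  nverts G <= N ->
  exists es : seq (nat * nat), let G' := induced G [fset x in S]%fset in
    [/\ uniq es, es =i edges G' &
     ev Induced (code_seq [:: d; code_nats S])
       (graph_code S es (groot G')) (Tind N)].
Proof.
move=> [vs [es [uvs eqvs ues eqes ->]]] uS sS leN; pose G' := induced G [fset x in S]%fset.
have leS : size S <= N.
  apply: leq_trans leN; rewrite /nverts; exact: (@uniq_leq_size _ S (enum_fset (verts G)) uS sS).
have leE : size es <= N * N.
  by apply: leq_trans (size_edges ues eqes) _; apply: leq_mul.
pose pe (e : nat * nat) := (e.1 \in S) && (e.2 \in S).
exists (rev (filter pe es)); split.
- by rewrite rev_uniq filter_uniq.
- move=> e; rewrite mem_rev mem_filter eqes /G' /edges /= !inE.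
  by rewrite andbC.
rewrite -/(code_nats vs) -/(graph_code vs es (groot G)).
have evr : ev (If (GR 0)
         (If (Call Mem [:: Seq (GR 0) (Prim Fst); Var 1]) (GR 0) (Prim (Const 0)))
         (Prim (Const 0)))
    (code_seq [:: graph_code vs es (groot G); code_nats S])
    (code_root (groot G')) (Tmem N + 50).
  eapply ev_le.
    apply: ev_if; first by rewrite /GR; evs.
      rewrite /=; case E: (groot G) => [r|] //= _.
      apply: ev_if.
      - eapply ev_call2; [rewrite /GR; evs|evs|exact: (ev_mem r leS)].
      - rewrite truthy_bool => rS; rewrite /groot /= E inE rS /GR; by evs.
      - rewrite truthy_bool => /negPf rS; rewrite /groot /= E inE rS; by evs.
    rewrite /=; case E: (groot G) => [r|] //= _.
    rewrite /groot /= E; by evs.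
  by lia.
have [] := @ev_fold (seq (nat * nat)) _ code_edge (fun s => code_seq (map code_edge s))
  (fun p s => s = rev (filter pe p))
  (code_seq [:: graph_code vs es (groot G); code_nats S])
  (GE 0) (Prim (Const 0))
  (If (Call Mem [:: Seq (Var 0) (Prim Fst); Var 3])
           (If (Call Mem [:: Seq (Var 0) (Prim Snd); Var 3])
              (Fork (Var 0) (Var 1)) (Var 1))
           (Var 1))
  es [::] (N * N) (2 * Tmem N + 70) 5 1.
- by eapply ev_le; [rewrite /GE; evs|].
- by evs.
- by [].
- by [].
- move=> p e q b _ ->; exists (rev (filter pe (rcons p e))) => //.
  eapply ev_le.
    apply: ev_if; first by eapply ev_call2; [evs|evs|exact: (ev_mem e.1 leS)].
      rewrite truthy_bool filter_rcons {2}/pe => ->.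
      apply: ev_if; first by eapply ev_call2; [evs|evs|exact: (ev_mem e.2 leS)].
        rewrite truthy_bool => ->; rewrite rev_rcons; by evs.
      rewrite truthy_bool => /negPf ->; by evs.
    rewrite truthy_bool filter_rcons {2}/pe => /negPf ->; by evs.
  by lia.
move=> s -> ev_s; rewrite {2}/graph_code /Induced.
eapply ev_le; first by apply: ev_fork; [evs | apply: ev_fork ev_s evr].
by rewrite /Tind; lia.
Qed.

(** * Set systems *)

Definition fs (s : seq nat) : {fset nat} := [fset x in s]%fset.

Lemma in_fs s x : (x \in fs s) = (x \in s).
Proof. by rewrite inE. Qed.

Lemma fs_cons x s : fs (x :: s) = (x |` fs s)%fset.
Proof. by apply/fsetP => y; rewrite !inE. Qed.

Lemma fs_sub s (A : {fset nat}) : reflect {subset s <= A} (fs s `<=` A)%fset.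
Proof.
apply: (iffP idP) => [/fsubsetP sA x xs|sA]; first by apply: sA; rewrite in_fs.
by apply/fsubsetP => x; rewrite in_fs => /sA.
Qed.

Definition maxi (F : {fset nat} -> Prop) (U S : {fset nat}) : Prop :=
  [/\ F S, (S `<=` U)%fset &
      forall T, F T -> (S `<=` T)%fset -> (T `<=` U)%fset -> T = S].

(** This is strong accessibility of a set system, except that the empty set is not asked to belong
    to it. *)
Definition augmentable (F : {fset nat} -> Prop) : Prop :=
  forall S T, F S -> F T -> (S `<` T)%fset ->
  exists w, [/\ w \in T, w \notin S & F (w |` S)%fset].

Definition removable (F : {fset nat} -> Prop) (v : nat) (U : {fset nat}) : Prop :=
  forall S, F S -> (S `<=` v |` U)%fset -> F (S `\ v)%fset.

Section SetSystem.

Variable F : {fset nat} -> Prop.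

Local Open Scope fset_scope.

(** A strictly larger competitor would supply, by augmentability, a single admissible element of
    [U]. *)
Lemma saturated_maxi U S : augmentable F -> F S -> S `<=` U ->
  (forall w, w \in U -> w \notin S -> ~ F (w |` S)) -> maxi F U S.
Proof.
move=> aug FS SU sat; split=> // T FT ST TU; apply/eqP.
rewrite eq_sym; apply: contraT => nST.
have [|w [wT wS Fw]] := aug S T FS FT; first by rewrite fproperEneq nST.
by case: (sat w (fsubsetP TU _ wT) wS).
Qed.

Lemma maxi_extend U S : F S -> S `<=` U -> exists2 S', S `<=` S' & maxi F U S'.
Proof.
have [n] := ubnP (#|` U| - #|` S|); elim: n S => // n IH S ltn FS SU.
have [mS|nmS] := pselect (maxi F U S); first by exists S.
have [T [FT ST TU nTS]] : exists T, [/\ F T, S `<=` T, T `<=` U & T <> S].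
  apply: contrapT => nex; apply: nmS; split=> // T FT ST TU.
  by apply: contrapT => nTS; apply: nex; exists T.
have ltST : (#|` S| < #|` T|)%N.
  by apply: fproper_ltn_card; rewrite fproperEneq ST andbT eq_sym; apply/eqP.
have leTU := fsubset_leq_card TU.
have [|//||S' TS' mS'] := IH T; [lia|by []|].
by exists S' => //; apply: fsubset_trans TS'.
Qed.

Lemma maxi_remove v U C : removable F v U -> maxi F (v |` U) C ->
  F (C `\ v) /\ C `\ v `<=` U.
Proof. by move=> rem [FC CU _]; split; [apply: rem | rewrite fsubDset]. Qed.

(** Extend [H] to a maximal [C] of the larger ground set. Without [v], this [C] is still in [F],
    lies in [U] and contains [H], so it equals [H] by maximality. *)
Lemma maxi_lift v U H : removable F v U -> v \notin U -> maxi F U H ->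
  exists2 C, maxi F (v |` U) C & C `\ v = H.
Proof.
move=> rem nvU [FH HU maxH].
have [|C HC mC] := @maxi_extend (v |` U) H FH.
  by apply: fsubset_trans HU _; apply: fsubsetU1.
exists C => //; have [FCv CvU] := maxi_remove rem mC.
apply: maxH => //; rewrite fsubsetD1 HC.
by apply: contra nvU => /(fsubsetP HU).
Qed.

(** [C] fits into [H] with [v] added, and every competitor there is also a competitor in [U] with
    [v] added. *)
Lemma maxi_local v U H C : H `<=` U -> C `\ v `<=` H -> maxi F (v |` U) C ->
  maxi F (v |` H) C.
Proof.
move=> HU CH [FC CU mC]; split=> //; first by rewrite -fsubDset.
move=> T FT CT TH; apply: mC => //; apply: fsubset_trans TH _.
exact: fsetUS.
Qed.

End SetSystem.

(** Lists represent sets. Distinctness is required of the sets, so that two orderings of one set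
    cannot both occur. *)
Definition enumerates (L : seq (seq nat)) (Q : {fset nat} -> Prop) : Prop :=
  [/\ all uniq L, uniq (map fs L) & forall S, S \in map fs L <-> Q S].

Lemma enumerates_cons L (Q Q' : {fset nat} -> Prop) C :
  enumerates L Q -> uniq C -> ~ Q (fs C) ->
  (forall S, Q' S <-> S = fs C \/ Q S) -> enumerates (C :: L) Q'.
Proof.
move=> [aL uL LP] uC nQC Q'P; split=> /=; first by rewrite uC.
- by rewrite uL andbT; apply/negP => /LP.
- move=> S; rewrite inE; split=> [/orP[/eqP eS|/LP QS]|/Q'P[->|/LP QS]].
  + by apply/Q'P; left.
  + by apply/Q'P; right.
  + by rewrite eqxx.
  + by rewrite QS orbT.
Qed.

Lemma enumerates_iff L (Q Q' : {fset nat} -> Prop) :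
  enumerates L Q -> (forall S, Q' S <-> Q S) -> enumerates L Q'.
Proof.
move=> [aL uL LP] Q'P; split=> // S; split=> [/LP QS|/Q'P QS].
  exact/Q'P.
exact/LP.
Qed.

(** * Induced subgraphs as vertex sets *)

Section Induced.

Variable G : graph.

Local Open Scope fset_scope.

Lemma verts_induced S : verts (induced G S) = verts G `&` S.
Proof. by []. Qed.

Lemma in_induced_edges S e :
  (e \in edges (induced G S)) = (e \in edges G) && ((e.1 \in S) && (e.2 \in S)).
Proof. by rewrite /edges /= !inE. Qed.

Lemma edge_verts u v : edge G u v -> (u \in verts G) /\ (v \in verts G).
Proof.
rewrite /edge /edges /verts; case: G => [[[V E] r] /= wf] uvE.
by case/andP: (wf) => /fsubsetP/(_ _ uvE); rewrite inE => /andP[].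
Qed.

Lemma groot_verts r : groot G = Some r -> r \in verts G.
Proof.
rewrite /groot /verts; case: G => [[[V E] r'] /= wf] er.
by move: wf; rewrite er => /andP[].
Qed.

Lemma groot_induced S : groot (induced G S) =
  if groot G is Some x then if x \in S then Some x else None else None.
Proof. by []. Qed.

Lemma graph_eq (H1 H2 : graph) : verts H1 = verts H2 -> edges H1 = edges H2 ->
  groot H1 = groot H2 -> H1 = H2.
Proof.
rewrite /verts /edges /groot => eV eE er; apply: val_inj => /=.
by move: eV eE er; case: (triple_of H1) => [[? ?] ?]; case: (triple_of H2) => [[? ?] ?] /= -> -> ->.
Qed.

End Induced.

Section InducedSubset.

Variable G : graph.

Local Open Scope fset_scope.

Lemma induced_induced T S : S `<=` T -> induced (induced G T) S = induced G S.
Proof.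
move=> /fsubsetP ST; apply: graph_eq.
- rewrite !verts_induced; apply/fsetP => x; rewrite !inE.
  by have [/ST ->|] := boolP (x \in S); rewrite ?andbT ?andbF.
- apply/fsetP => -[u v]; rewrite !in_induced_edges /=.
  case uS: (u \in S); case vS: (v \in S); rewrite ?andbF //=.
  by rewrite (ST _ uS) (ST _ vS) !andbT.
- rewrite !groot_induced; case: (groot G) => // r.
  have [rS|nrS] := boolP (r \in S); first by rewrite (ST _ rS) rS.
  by case: ifP => // _; rewrite (negPf nrS).
Qed.

Lemma induced_verts : induced G (verts G) = G.
Proof.
apply: graph_eq.
- by rewrite verts_induced fsetIid.
- apply/fsetP => -[u v]; rewrite in_induced_edges /=.
  case uv: (_ \in edges G) => //=.
  by have [-> ->] := edge_verts uv.
- by rewrite groot_induced; case E: (groot G) => [r|] //; rewrite (groot_verts E).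
Qed.

Lemma verts_induced_sub S : S `<=` verts G -> verts (induced G S) = S.
Proof. by rewrite verts_induced => /fsetIidPr. Qed.

Lemma sub_IS_induced S T : S `<=` verts G -> T `<=` verts G ->
  sub_IS (induced G S) (induced G T) <-> S `<=` T.
Proof.
move=> SV TV; split=> [[S0]|ST].
  rewrite (verts_induced_sub TV) => S0T; rewrite induced_induced // => e.
  have := congr1 verts e.
  by rewrite !verts_induced_sub //; [move=> -> | apply: fsubset_trans TV].
by exists S; rewrite ?verts_induced_sub ?induced_induced.
Qed.

End InducedSubset.

Section Family.

Variables (P : graph -> Prop) (G : graph).

Local Open Scope fset_scope.

Definition family (S : {fset nat}) : Prop :=
  S `<=` verts G /\ P (induced G S).

(** On vertex sets the induced-subgraph order is inclusion, and an induced subgraph of an induced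
    subgraph of [G] is one of [G]. Hence the single family of [G] serves all prefixes [T]. *)
Lemma maximal_P_subgraphE T X : T `<=` verts G ->
  maximal_P_subgraph P (induced G T) X <->
  exists2 S, maxi family T S & X = induced G S.
Proof.
move=> TV; split.
  case=> [[[S]]]; rewrite verts_induced_sub // => ST; rewrite induced_induced // => -> PS mS.
  have SV := fsubset_trans ST TV.
  exists S => //; split=> // T' [T'V PT'] ST' T'T.
  apply: contrapT => nT'S; apply: (mS (induced G T')).
    by split=> //; apply/sub_IS_induced.
  split; first exact/sub_IS_induced.
  by move=> /(congr1 verts); rewrite !verts_induced_sub // => /esym.
case=> S [[SV PS] ST mS] ->; split; first by split=> //; apply/sub_IS_induced.
move=> X' [[T']]; rewrite verts_induced_sub // => T'T; rewrite induced_induced // => -> PT'.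
have T'V := fsubset_trans T'T TV.
case=> /(sub_IS_induced SV T'V) ST' nST'; apply: nST'; congr induced.
by apply/esym/mS.
Qed.

End Family.

Lemma codes_graph_code G S (es : seq (nat * nat)) : uniq S -> {subset S <= verts G} ->
  uniq es -> es =i edges (induced G (fs S)) ->
  codes (graph_code S es (groot (induced G (fs S)))) (induced G (fs S)).
Proof.
move=> uS sS ues ees; exists S, es; split=> // x.
by rewrite verts_induced_sub ?in_fs //; apply/fs_sub.
Qed.

Lemma nverts_induced G S : nverts (induced G S) <= nverts G.
Proof. by apply: fsubset_leq_card; apply: fsubsetIl. Qed.

Lemma size_le_nverts G S N : uniq S -> {subset S <= verts G} -> nverts G <= N ->
  size S <= N.
Proof.
move=> uS sS leN; apply: leq_trans leN.
exact: (@uniq_leq_size _ S (enum_fset (verts G)) uS sS).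
Qed.

(** * Inserting one vertex *)

(** [N] is any upper bound on the number of vertices, so that subgraphs share the time bound of the
    whole input. *)
Definition decides (P : graph -> Prop) (dec : prog) (T : nat -> nat) : Prop :=
  forall G d N, codes d G -> nverts G <= N ->
  exists2 b, truthy b <-> P G & ev dec d b (T N).

Definition solves_restricted (P : graph -> Prop) (ir : prog) (T : nat -> nat) : Prop :=
  forall G d N, almost_satisfies P G -> codes d G -> nverts G <= N ->
  exists out K, lists out (maximal_P_subgraph P G) K /\ ev ir d out (T N).

Definition Decide_induced (dec : prog) : prog := Seq Induced dec.

Lemma ev_decide_induced P dec T d G S N :
  decides P dec T -> codes d G -> uniq S -> {subset S <= verts G} -> nverts G <= N ->
  exists2 b, truthy b <-> P (induced G (fs S)) &
    ev (Decide_induced dec) (code_seq [:: d; code_nats S]) b (Tind N + T N + 1).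
Proof.
move=> decP dG uS sS leN.
have [es [ues ees evI]] := ev_induced dG uS sS leN.
have cG := codes_graph_code uS sS ues ees.
have [|b bP evb] := decP _ _ N cG; first exact: leq_trans (nverts_induced _ _) leN.
exists b => //; apply: ev_le (ev_seq evI evb) _; lia.
Qed.

(* Extends a P-subset of [ws] to a maximal one; environment [ws; S; graph]. *)
Definition Greedy (dec : prog) : prog :=
  Close (If (Call Mem [:: Var 0; Var 1]) (Prim (Const 0))
           (Call (Decide_induced dec) [:: Var 6; Fork (Var 0) (Var 1)]))
        (Fork (Var 0) (Var 1)).

Definition Tgreedy (T : nat -> nat) (N : nat) : nat :=
  N * (N * (2 * (Tmem N + Tind N + T N + 60) + 30) + 60) + 30.

Definition greedy_spec P G d dec T N (ws S S' : seq nat) : Prop :=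
  [/\ uniq S', {subset S' <= ws}, (fs S `<=` fs S')%fset,
      maxi (family P G) (fs ws) (fs S') &
      ev (Greedy dec) (code_seq [:: code_nats ws; code_nats S; d])
        (code_nats S') (Tgreedy T N)].

Lemma ev_greedy P G d dec T N ws S :
  decides P dec T -> augmentable (family P G) -> codes d G -> nverts G <= N ->
  uniq ws -> {subset ws <= verts G} -> uniq S -> {subset S <= ws} ->
  family P G (fs S) -> exists S', greedy_spec P G d dec T N ws S S'.
Proof.
move=> decP aug dG leN uws sws uS sS FS.
pose Inv s := [/\ uniq s, {subset s <= ws}, (fs S `<=` fs s)%fset & family P G (fs s)].
pose adm s w := w \notin s /\ family P G (fs (w :: s)).
have lews := size_le_nverts uws sws leN.
have [] := @ev_close (seq nat) code_nats id adm Inv ws S (code_seq [:: d])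
  (If (Call Mem [:: Var 0; Var 1]) (Prim (Const 0))
           (Call (Decide_induced dec) [:: Var 6; Fork (Var 0) (Var 1)]))
        (Fork (Var 0) (Var 1)) N (Tmem N + Tind N + T N + 60) lews.
- by split.
- by move=> s [].
- by move=> s w [].
- move=> w s x1 x2 x3 x4 w_ws [us ss SS Fs].
  have lesz : size s <= N by apply: leq_trans (uniq_leq_size us ss) lews.
  have [ws'|nws] := boolP (w \in s).
    exists (Leaf 0); first by split=> // -[]; rewrite ws'.
    eapply ev_le.
      apply: (@ev_if _ _ _ _ _ _ _ 1 0); first by eapply ev_call2; [evs|evs|exact: (ev_mem w lesz)].
        by move=> _; evs.
      by rewrite truthy_bool ws'.
    by lia.
  have u1 : uniq (w :: s) by rewrite /= nws.
  have s1 : {subset w :: s <= verts G}.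
    by move=> x; rewrite inE => /orP[/eqP->|/ss]; apply: sws.
  have [b bP evb] := ev_decide_induced decP dG u1 s1 leN.
  exists b.
    split=> [/bP Pw|[_ [_ Pw]]]; last exact/bP.
    by split=> //; split=> //; apply/fs_sub.
  eapply ev_le.
    apply: (@ev_if _ _ _ _ _ _ _ 0); first by eapply ev_call2; [evs|evs|exact: (ev_mem w lesz)].
      by rewrite truthy_bool (negPf nws).
    move=> _; eapply ev_call2; [evs|evs|exact: evb].
  by lia.
- move=> w s x1 x2 x3 x4 w_ws [us ss SS Fs] [nws Fws].
  exists (w :: s); split=> //.
    split=> //; first by rewrite /= nws.
      by move=> x; rewrite inE => /orP[/eqP->|/ss].
    by apply: fsubset_trans SS _; rewrite fs_cons; apply: fsubsetU1.
  by eapply ev_le; [evs|lia].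
move=> s [[us ss SS Fs] sat evs_]; exists s; split=> //.
apply: saturated_maxi => //.
  by apply/fs_sub => x /ss; rewrite in_fs.
move=> w; rewrite !in_fs => w_ws nws Fw; apply: (sat w w_ws); split=> //.
by rewrite fs_cons.
Qed.

(* A candidate [C] found below [H] is kept when it is maximal in [w :: proc] and
   [H] is its canonical parent, the greedy extension of [C] minus [w] in [proc];
   environment [C; H; w; proc; graph]. *)
Definition Accept (dec : prog) : prog :=
  If (Call Sub_list
        [:: Call (Greedy dec) [:: Fork (Var 2) (Var 3); Var 0; Var 4]; Var 0])
     (Call Sub_list
        [:: Call (Greedy dec) [:: Var 3; Call Restrict [:: Var 0; Var 3]; Var 4];
            Var 1])
     (Prim (Const 0)).

Definition Taccept (T : nat -> nat) (N : nat) : nat :=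
  2 * Tgreedy T N + 3 * Tsub N + 200.

Definition code_sets (L : seq (seq nat)) : data := code_seq (map code_nats L).

(* Environment [w; proc; Hs; graph]. *)
Definition Step (dec ir : prog) : prog :=
  Fold (Var 2) (Prim (Const 0))
    (Fold (Seq (Call Induced [:: Var 5; Fork (Var 2) (Var 0)]) ir) (Var 1)
       (If (Call (Accept dec) [:: Seq (Var 0) (Prim Fst); Var 2; Var 4; Var 5; Var 7])
          (Fork (Seq (Var 0) (Prim Fst)) (Var 1))
          (Var 1))).

(** Bounds the number of candidates from one call of the restricted algorithm: the height of the
    input code plus the running time. *)
Definition Ncand (T' : nat -> nat) (N : nat) : nat := N + N * N + 10 + T' N.

Definition Thead (T T' : nat -> nat) (N : nat) : nat :=
  Tind N + T' N + Ncand T' N * (Taccept T N + 100) + 100.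

Definition Tstep (T T' : nat -> nat) (M N : nat) : nat := M * Thead T T' N + 50.

(** Only the vertex list of each output graph is kept for use; the rest of its code travels along as
    opaque data. *)
Lemma Forall2_codes ds Hs : List.Forall2 codes ds Hs ->
  exists ys : seq (seq nat * data),
    [/\ ds = [seq Node (code_nats y.1) y.2 | y <- ys],
        [seq fs y.1 | y <- ys] = map verts Hs & all uniq (map fst ys)].
Proof.
elim=> {ds Hs} [|d H ds Hs [vs [es [uvs evs_ _ _ ->]]] _ [ys [-> eys uys]]].
  by exists [::].
exists ((vs, Node (code_seq (map code_edge es)) (code_root (groot H))) :: ys).
split=> //=; last by rewrite uvs.
by rewrite eys; congr cons; apply/fsetP => x; rewrite in_fs evs_.
Qed.

Lemma lists_enumerates P G U out K : (U `<=` verts G)%fset ->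
  lists out (maximal_P_subgraph P (induced G U)) K ->
  exists2 ys : seq (seq nat * data),
    out = code_seq [seq Node (code_nats y.1) y.2 | y <- ys] &
    enumerates (map fst ys) (maxi (family P G) U).
Proof.
move=> UV [ds [Hs [-> /Forall2_codes[ys [-> eys uys]] uHs HsP _]]].
exists ys => //; split=> //.
  rewrite -map_comp eys map_inj_in_uniq // => H1 H2.
  move=> /HsP/(maximal_P_subgraphE P H1 UV)[S1 [[S1V _] _ _] ->].
  move=> /HsP/(maximal_P_subgraphE P H2 UV)[S2 [[S2V _] _ _] ->].
  by rewrite !verts_induced_sub // => ->.
move=> S; rewrite -map_comp eys; split.
  case/mapP => H /HsP/(maximal_P_subgraphE P H UV)[S' mS' ->] ->.
  by case: (mS') => -[S'V _] _ _; rewrite verts_induced_sub.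
move=> mS; apply/mapP; exists (induced G S).
  by apply/HsP/(maximal_P_subgraphE P _ UV); exists S.
by case: mS => -[SV _] _ _; rewrite verts_induced_sub.
Qed.

Lemma height_graph_code S (es : seq (nat * nat)) r N :
  size S <= N -> size es <= N * N -> height (graph_code S es r) <= N + N * N + 9.
Proof.
move=> leS leE; rewrite /graph_code /=.
have hS : height (code_nats S) <= size S + 0.
  rewrite -(size_map Leaf S); apply: height_code_seq => x.
  by elim: S {leS} => //= a S IH [<-|/IH].
have hE : height (code_seq (map code_edge es)) <= size es + 1.
  rewrite -(size_map code_edge es); apply: height_code_seq => x.
  by elim: es {leE} => //= a s IH [<-|/IH].
have hr : height (code_root r) <= 1 by case: r.
by lia.
Qed.

Section Step.

Variables (P : graph -> Prop) (dec ir : prog) (T T' : nat -> nat).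
Variables (G : graph) (d : data) (N : nat).
Hypotheses (decP : decides P dec T) (irP : solves_restricted P ir T').
Hypotheses (dG : codes d G) (leN : nverts G <= N).

Notation F := (family P G).

Hypothesis aug : augmentable F.

Variables (w : nat) (proc : seq nat).
Hypotheses (wG : w \in verts G) (w_proc : w \notin proc).
Hypotheses (uproc : uniq proc) (sproc : {subset proc <= verts G}).
Hypothesis rem : removable F w (fs proc).

Local Lemma uniq_wproc : uniq (w :: proc).
Proof. by rewrite /= w_proc. Qed.

Local Lemma sub_wproc : {subset w :: proc <= verts G}.
Proof. by move=> x; rewrite inE => /orP[/eqP->|/sproc]. Qed.

Lemma restrict_remove C : {subset C <= w :: proc} ->
  fs (rev [seq x <- proc | x \in C]) = (fs C `\ w)%fset.
Proof.
move=> sC; apply/fsetP => x; rewrite in_fs mem_rev mem_filter !inE.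
have [xC|] /= := boolP (x \in C); last by rewrite andbF.
have := sC x xC; rewrite inE andbT; case: eqP => [->|] //= _.
exact: negPf.
Qed.

(** Names the result of greedy extension as a function of the starting list, so that the canonical
    parent becomes a value. *)
Variable g : seq nat -> seq nat.
Hypothesis gP : forall S, uniq S -> {subset S <= proc} -> F (fs S) ->
  greedy_spec P G d dec T N proc S (g S).

Definition kept (H C : {fset nat}) : Prop :=
  maxi F (w |` fs proc)%fset C /\ fs (g (rev [seq x <- proc | x \in C])) = H.

Lemma filter_fs C : [seq x <- proc | x \in fs C] = [seq x <- proc | x \in C].
Proof. by apply: eq_filter => x; rewrite in_fs. Qed.

(** [C] is maximal exactly when its greedy extension adds nothing. The greedy extension of [C] minus
    [w] and the set [H] are both maximal in [proc], so inclusion of the first in the second already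
    means equality. *)
Lemma ev_accept C H : uniq C -> {subset C <= w :: proc} -> F (fs C) ->
  uniq H -> maxi F (fs proc) (fs H) ->
  exists2 b, truthy b <-> kept (fs H) (fs C) &
    ev (Accept dec)
      (code_seq [:: code_nats C; code_nats H; Leaf w; code_nats proc; d]) b
      (Taccept T N).
Proof.
move=> uC sC FC uH mH; rewrite /kept filter_fs.
have leP := size_le_nverts uproc sproc leN.
have sCG : {subset C <= verts G} by move=> x /sC /sub_wproc.
have leC := size_le_nverts uC sCG leN.
have sH : {subset H <= proc}.
  by move=> x xH; rewrite -in_fs; case: mH => _ /fsubsetP s _; apply: s; rewrite in_fs.
have leH : size H <= N by apply: leq_trans (uniq_leq_size uH sH) leP.
have [C' [uC' sC' CC' mC' evC']] :=
  ev_greedy decP aug dG leN uniq_wproc sub_wproc uC sC FC.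
have leC' := leq_trans (uniq_leq_size uC' sC') (size_le_nverts uniq_wproc sub_wproc leN).
pose R := rev [seq x <- proc | x \in C].
have uR : uniq R by rewrite rev_uniq filter_uniq.
have sR : {subset R <= proc} by move=> x; rewrite mem_rev mem_filter => /andP[].
have FR : F (fs R).
  rewrite restrict_remove //; apply: rem => //.
  by rewrite -fs_cons; apply/fs_sub => x /sC; rewrite in_fs.
have [uR' sR' _ mR' evR'] := gP uR sR FR.
have leR' := leq_trans (uniq_leq_size uR' sR') leP.
have maxC : all [in C] C' = true <-> maxi F (w |` fs proc)%fset (fs C).
  rewrite -fs_cons; split=> [/allP CC|[_ _ mC]].
    suff <- : fs C' = fs C by [].
    apply/eqP; rewrite eqEfsubset CC' andbT; apply/fs_sub => x /CC.
    by rewrite in_fs.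
  have eC : fs C' = fs C by case: mC' => FC' sC'' _; apply: mC.
  by apply/allP => x xC'; rewrite /= -in_fs -eC in_fs.
have parR : all [in H] (g R) = true <-> fs (g R) = fs H.
  split=> [/allP RH|eR]; last by apply/allP => x xR; rewrite /= -in_fs -eR in_fs.
  case: mR' => _ _ mR'; apply/esym/mR'; [by case: mH| |by case: mH].
  by apply/fs_sub => x /RH; rewrite in_fs.
have ev1 : ev (Call Sub_list
        [:: Call (Greedy dec) [:: Fork (Var 2) (Var 3); Var 0; Var 4]; Var 0])
    (code_seq [:: code_nats C; code_nats H; Leaf w; code_nats proc; d])
    (code_bool (all [in C] C')) (Tgreedy T N + Tsub N + 50).
  eapply ev_le.
    eapply ev_call2; [|evs|exact: (ev_sub_list leC' leC)].
    by eapply ev_call3; [evs|evs|evs|exact: evC'].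
  by clear; lia.
have ev2 : ev (Call Sub_list
        [:: Call (Greedy dec) [:: Var 3; Call Restrict [:: Var 0; Var 3]; Var 4];
            Var 1])
    (code_seq [:: code_nats C; code_nats H; Leaf w; code_nats proc; d])
    (code_bool (all [in H] (g R))) (Tgreedy T N + 2 * Tsub N + 49).
  eapply ev_le.
    eapply ev_call2; [|evs|exact: (ev_sub_list leR' leH)].
    eapply ev_call3; [evs| |evs|exact: evR'].
    by eapply ev_call2; [evs|evs|exact: (ev_restrict leC leP)].
  by clear; lia.
exists (if all [in C] C' then code_bool (all [in H] (g R)) else Leaf 0).
  case: ifP => aC; last by split=> // -[/maxC]; rewrite aC.
  by rewrite truthy_bool; split=> [/parR ->|[_ /parR]//]; split=> //; apply/maxC.
eapply ev_le.
  apply: (ev_if (C := 1) ev1); rewrite truthy_bool.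
    by move=> ->; exact: ev2.
  by move=> /negPf ->; evs.
by rewrite /Taccept; clear; lia.
Qed.

(** Deleting [w] from the graph induced on [w :: H] leaves the graph on [H], which is in [P]; so the
    restricted algorithm applies. *)
Lemma ev_candidates H : uniq H -> maxi F (fs proc) (fs H) ->
  exists ys : seq (seq nat * data),
  [/\ enumerates (map fst ys) (maxi F (w |` fs H)%fset), size ys <= Ncand T' N &
      forall x1 x3 x4,
      ev (Seq (Call Induced [:: Var 5; Fork (Var 2) (Var 0)]) ir)
        (code_seq [:: code_nats H; x1; Leaf w; x3; x4; d])
        (code_seq [seq Node (code_nats y.1) y.2 | y <- ys])
        (Tind N + T' N + 40)].
Proof.
move=> uH mH.
have sH : {subset H <= proc}.
  by move=> x xH; rewrite -in_fs; case: mH => _ /fsubsetP s _; apply: s; rewrite in_fs.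
have uwH : uniq (w :: H) by rewrite /= uH andbT; apply: contra w_proc => /sH.
have swH : {subset w :: H <= verts G}.
  by move=> x; rewrite inE => /orP[/eqP->|/sH/sproc].
have [es [ues ees evI]] := ev_induced dG uwH swH leN.
have cG := codes_graph_code uwH swH ues ees.
have wHG : (fs (w :: H) `<=` verts G)%fset by apply/fs_sub.
have leN' : nverts (induced G (fs (w :: H))) <= N.
  exact: leq_trans (nverts_induced _ _) leN.
have alm : almost_satisfies P (induced G (fs (w :: H))).
  exists w; first by rewrite verts_induced_sub // in_fs mem_head.
  rewrite /del_vertex verts_induced_sub // induced_induced; last exact: fsubD1set.
  suff -> : (fs (w :: H) `\ w)%fset = fs H by case: mH => -[].
  by rewrite fs_cons fsetU1K // in_fs; case/andP: uwH.
have [out [K [lout evout]]] := irP alm cG leN'.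
have [ys eout eys] := lists_enumerates wHG lout.
exists ys; split; first by rewrite -fs_cons.
  have leS := size_le_nverts uwH swH leN.
  have leE : size es <= N * N.
    by apply: leq_trans (size_edges ues ees) _; apply: leq_mul.
  (* The number of candidates is at most the height of the output, which the running time
     controls. *)
  case: evout => t rt let_; have := run_height rt; rewrite eout.
  have := size_le_height [seq Node (code_nats y.1) y.2 | y <- ys]; rewrite size_map.
  have := height_graph_code (groot (induced G (fs (w :: H)))) leS leE.
  by rewrite /Ncand; lia.
move=> x1 x3 x4; rewrite -eout; eapply ev_le.
  eapply ev_seq; last exact: evout.
  by eapply ev_call2; [evs|evs|exact: evI].
by clear; lia.
Qed.

(** The canonical parent contains [C] minus [w], so maximality localizes: every set to be kept from
    [H] does occur among the candidates computed from [H]. *)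
Lemma kept_local H C : maxi F (fs proc) H -> {subset C <= w :: proc} ->
  kept H (fs C) -> maxi F (w |` H)%fset (fs C).
Proof.
move=> mH sC [mC eH]; have [FR sR] := maxi_remove rem mC.
apply: (@maxi_local F w (fs proc)) => //; first by case: mH.
rewrite -eH filter_fs -(restrict_remove sC).
have [|||_ _ sub_g _ _] := gP (S := rev [seq x <- proc | x \in C]); last exact: sub_g.
- by rewrite rev_uniq filter_uniq.
- by move=> x; rewrite mem_rev mem_filter => /andP[].
- by rewrite restrict_remove.
Qed.

(** Each maximal set of the new prefix is kept from exactly one [H], its canonical parent, which is
    maximal in [proc] and hence in [Hs]. The restricted algorithm is called once per element of
    [Hs]. *)
Lemma ev_step Hs M : enumerates Hs (maxi F (fs proc)) -> size Hs <= M ->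
  exists2 Hs', enumerates Hs' (maxi F (w |` fs proc)%fset) &
    ev (Step dec ir)
      (code_seq [:: Leaf w; code_nats proc; code_sets Hs; d])
      (code_sets Hs') (Tstep T T' M N).
Proof.
move=> [aHs uHs HsP] leM.
pose Inv p L := enumerates L (fun C => exists2 H, H \in map fs p & kept H C).
(* The body bound is [Thead] less the 20 that a fold adds per element, so the total is [M] times
   [Thead]. *)
have [] := @ev_fold (seq (seq nat)) (seq nat) code_nats code_sets Inv
  (code_seq [:: Leaf w; code_nats proc; code_sets Hs; d])
  (Var 2) (Prim (Const 0))
  (Fold (Seq (Call Induced [:: Var 5; Fork (Var 2) (Var 0)]) ir) (Var 1)
       (If (Call (Accept dec) [:: Seq (Var 0) (Prim Fst); Var 2; Var 4; Var 5; Var 7])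
          (Fork (Seq (Var 0) (Prim Fst)) (Var 1))
          (Var 1))) Hs [::] M (Thead T T' N - 20) 5 1.
- by evs.
- by evs.
- by [].
- by split=> // S; split=> // -[].
- move=> p H q acc eHs InvL.
  have uH : uniq H by move: aHs; rewrite eHs all_cat /= => /and3P[].
  have mH : maxi F (fs proc) (fs H).
    by apply/HsP; rewrite eHs map_cat mem_cat /= mem_head orbT.
  have Hp : fs H \notin map fs p.
    by move: uHs; rewrite eHs map_cat cat_uniq /= negb_or => /and3P[_ /andP[]].
  have [ys [[uys1 uys ysP] leys evys]] := ev_candidates uH mH.
  pose Inv' (q' : seq (seq nat * data)) L := enumerates L (fun C => (exists2 H, H \in map fs p & kept H C) \/
     C \in map fs (map fst q') /\ kept (fs H) C).
  have [] := @ev_fold (seq (seq nat)) (seq nat * data)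
    (fun y => Node (code_nats y.1) y.2) code_sets Inv'
    (code_seq [:: code_nats H; code_sets acc; Leaf w; code_nats proc; code_sets Hs; d])
    (Seq (Call Induced [:: Var 5; Fork (Var 2) (Var 0)]) ir) (Var 1)
    (If (Call (Accept dec) [:: Seq (Var 0) (Prim Fst); Var 2; Var 4; Var 5; Var 7])
          (Fork (Seq (Var 0) (Prim Fst)) (Var 1))
          (Var 1)) ys acc (Ncand T' N) (Taccept T N + 80) (Tind N + T' N + 40) 3.
  + exact: evys.
  + by evs.
  + by [].
  + apply: enumerates_iff InvL _ => S; split=> [[//|[]//]|]; by left.
  + move=> q' [C x] q'' L eys InvL'.
    have Cys : fs C \in map fs (map fst ys).
      by rewrite eys !map_cat mem_cat /= mem_head orbT.
    have uC : uniq C by move: uys1; rewrite eys map_cat all_cat /= => /and3P[].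
    have mC : maxi F (w |` fs H)%fset (fs C) by apply/ysP.
    have sC : {subset C <= w :: proc}.
      case: mC => _ sC _ y yC; rewrite -in_fs fs_cons.
      have HP : (w |` fs H `<=` w |` fs proc)%fset by apply: fsetUS; case: mH.
      by apply: (fsubsetP (fsubset_trans sC HP)); rewrite in_fs.
    have FC : F (fs C) by case: mC.
    have [b bP evb] := ev_accept uC sC FC uH mH.
    have evb' : ev (Call (Accept dec) [:: Seq (Var 0) (Prim Fst); Var 2; Var 4; Var 5; Var 7])
        (Node (Node (code_nats C) x) (Node (code_sets L)
          (code_seq [:: code_nats H; code_sets acc; Leaf w; code_nats proc; code_sets Hs; d])))
        b (Taccept T N + 60).
      eapply ev_le; first by eapply ev_call5; [evs|evs|evs|evs|evs|exact: evb].
      by clear; lia.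
    have Cq' : fs C \notin map fs (map fst q').
      move: uys; rewrite eys !map_cat cat_uniq /= negb_or.
      by case/and3P=> _ /andP[].
    have [tb|ntb] := boolP (truthy b).
      have kC := bP.1 tb.
      exists (C :: L); last first.
        eapply ev_le; first by apply: (ev_if (C := 0) evb'); [move=> _; evs | rewrite tb].
        by clear; lia.
      apply: (enumerates_cons InvL' uC).
        (* [C] is new: kept from an earlier parent, it would force that parent to equal [H], and the
           candidates of [H] are pairwise distinct. *)
        case=> [[H' H'p [_ eH']]|[]]; last by rewrite (negPf Cq').
        by move: Hp; case: kC => _ <-; rewrite eH' H'p.
      move=> S; rewrite map_rcons map_rcons mem_rcons inE.
      split=> [[ex|[/orP[/eqP->|Sq] kS]]|[->|[ex|[Sq kS]]]].
      * by right; left.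
      * by left.
      * by right; right.
      * by right; rewrite eqxx.
      * by left.
      * by right; rewrite Sq orbT.
    exists L; last first.
      eapply ev_le; first by apply: (ev_if (B := 0) evb'); [rewrite (negPf ntb) | move=> _; evs].
      by clear; lia.
    apply: enumerates_iff InvL' _ => S; rewrite map_rcons map_rcons mem_rcons inE.
    split=> [[ex|[/orP[/eqP->|Sq] kS]]|[ex|[Sq kS]]].
    * by left.
    * by case/negP: ntb; apply/bP.
    * by right.
    * by left.
    * by right; rewrite Sq orbT.
  move=> L InvL' evL; exists L; last by apply: ev_le evL _; rewrite /Thead; clear; lia.
  apply: enumerates_iff InvL' _ => S; rewrite map_rcons; split=> [[H']|].
    rewrite mem_rcons inE => /orP[/eqP->|H'p] kS; last by left; exists H'.
    right; split=> //; apply/ysP.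
    have sS : {subset enum_fset S <= w :: proc}.
      by case: kS => -[_ /fsubsetP sS _] _ y /sS; rewrite -fs_cons in_fs.
    have eS : fs (enum_fset S) = S by apply/fsetP => y; rewrite in_fs.
    by have := kept_local mH sS; rewrite eS; apply.
  case=> [[H' H'p kS]|[_ kS]].
    by exists H' => //; rewrite mem_rcons inE H'p orbT.
  by exists (fs H) => //; rewrite mem_rcons mem_head.
move=> Hs' InvHs' evHs'; exists Hs'; last first.
  apply: ev_le evHs' _; rewrite /Tstep.
  have -> : Thead T T' N - 20 + 20 = Thead T T' N by rewrite /Thead; clear; lia.
  by clear; lia.
apply: enumerates_iff InvHs' _ => C; split=> [mC|[H _ []//]].
pose R := rev [seq x <- proc | x \in C].
have [FR sR] := maxi_remove rem mC.
have eC : fs (enum_fset C) = C by apply/fsetP => y; rewrite in_fs.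
have eR : fs R = (C `\ w)%fset.
  have := @restrict_remove (enum_fset C); rewrite eC; apply.
  by case: mC => _ /fsubsetP sC _ y /sC; rewrite -fs_cons in_fs.
have [|||_ _ _ mg _] := gP (S := R).
- by rewrite rev_uniq filter_uniq.
- by move=> x; rewrite mem_rev mem_filter => /andP[].
- by rewrite eR.
by exists (fs (g R)) => //; apply/HsP.
Qed.

End Step.

(** * The enumeration algorithm *)

Inductive grown (adm : seq nat -> nat -> Prop) (V : {fset nat}) (base : seq nat) :
    seq nat -> Prop :=
  | grown_base : grown adm V base base
  | grown_cons s w : grown adm V base s -> w \in V -> adm s w ->
      grown adm V base (w :: s).

(* The conditions under which inserting the vertices in the order determined by
   [adm], starting from [base], turns the maximal P-subgraphs of each prefix
   into those of the next one. *)
Definition insertion_order (P : graph -> Prop) (G : graph)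
    (adm : seq nat -> nat -> Prop) (base : seq nat) : Prop :=
  [/\ uniq base /\ {subset base <= verts G},
      forall s w, adm s w -> w \notin s,
      forall s w, grown adm (verts G) base s -> w \in verts G -> adm s w ->
        removable (family P G) w (fs s),
      forall s, grown adm (verts G) base s ->
        (forall w, w \in verts G -> ~ adm s w) -> {subset verts G <= s} &
      forall S, family P G S -> family P G (fs base)].

(** Fixes the final number of maximal sets before the algorithm is analysed, since the cost of every
    insertion is bounded in terms of it. *)
Lemma enumerates_exists (U : {fset nat}) (Q : {fset nat} -> Prop) :
  (forall S, Q S -> (S `<=` U)%fset) -> exists L, enumerates L Q.
Proof.
move=> QU.
have fsK : forall S : {fset nat}, fs (enum_fset S) = S.
  by move=> S; apply/fsetP => x; rewrite in_fs.
exists [seq enum_fset A | A <- [seq A <- fpowerset U | `[< Q A >]]]; split.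
- by rewrite all_map (eq_all (a2 := predT)) ?all_predT // => A; apply: fset_uniq.
- by rewrite -map_comp (eq_map fsK) map_id filter_uniq // fset_uniq.
move=> S; rewrite -map_comp (eq_map fsK) map_id mem_filter.
split=> [/andP[/asboolP]//|QS]; rewrite fpowersetE QU // andbT.
exact/asboolP.
Qed.

Lemma enumerates_size L L' Q : enumerates L Q -> enumerates L' Q -> size L = size L'.
Proof.
move=> [_ u eP] [_ u' eP']; rewrite -(size_map fs L) -(size_map fs L').
apply/perm_size/uniq_perm => // S.
by apply/idP/idP => [/eP/eP'|/eP'/eP].
Qed.

Section Enumerate.

Variables (P : graph -> Prop) (G : graph).
Variables (adm : seq nat -> nat -> Prop) (base : seq nat).
Hypothesis ord : insertion_order P G adm base.

Notation F := (family P G).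
Notation grownG := (grown adm (verts G) base).

Lemma grown_sub s : grownG s -> uniq s /\ {subset s <= verts G}.
Proof.
case: ord => ub admN _ _ _; elim=> // {}s w _ [us ss] wV /admN nws.
by split=> [|x]; rewrite /= ?nws // inE => /orP[/eqP->|/ss].
Qed.

(** [H] is lifted through one insertion after another until no vertex is admissible, which means
    that all are in. Each lift changes only the inserted vertex, so the trace on [s] remains [H]. *)
Lemma maxi_grown_trace s H : grownG s -> maxi F (fs s) H ->
  exists2 K, maxi F (verts G) K & (K `&` fs s)%fset = H.
Proof.
case: ord => _ admN rem stuck _.
have [n] := ubnP (nverts G - size s); elim: n s H => // n IH s H ltn gs mH.
have [us ss] := grown_sub gs.
have [[w wV aw]|nadm] := pselect (exists2 w, w \in verts G & adm s w).
  have nws := admN _ _ aw.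
  have gws : grownG (w :: s) by apply: grown_cons.
  have [|C mC eC] := maxi_lift (rem _ _ gs wV aw) _ mH; first by rewrite in_fs.
  have lt_s : size s < nverts G.
    have [u1 s1] := grown_sub gws.
    exact: (size_le_nverts u1 s1 (leqnn _)).
  have [|//||K mK eK] := IH (w :: s) C; [by rewrite /=; lia|by rewrite fs_cons|].
  exists K => //; rewrite -eC -eK fs_cons; apply/fsetP => x; rewrite !inE.
  by case: eqP => [->|] //=; rewrite (negPf nws) andbF.
have eV : fs s = verts G.
  apply/eqP; rewrite eqEfsubset; apply/andP; split; first exact/fs_sub.
  apply/fsubsetP => x xV; rewrite in_fs; apply: (stuck s gs) => // w wV aw.
  by apply: nadm; exists w.
rewrite eV in mH; exists H => //; rewrite eV; apply/fsetIidPl.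
by case: mH.
Qed.

(* Passing to a further prefix never loses maximal P-subgraphs, so all
   intermediate lists are at most as long as the output. *)
Lemma enumerates_grown_le s Hs Ks : grownG s ->
  enumerates Hs (maxi F (fs s)) -> enumerates Ks (maxi F (verts G)) ->
  size Hs <= size Ks.
Proof.
move=> gs [_ uH HP] [_ _ KP].
rewrite -(size_map fs Hs) -(size_map fs Ks) -(size_map (fun K => K `&` fs s)%fset (map fs Ks)).
apply: uniq_leq_size => // S /HP/(maxi_grown_trace gs)[K mK <-].
by apply/mapP; exists K => //; apply/KP.
Qed.

End Enumerate.

(** The state pairs the current prefix with the list of its maximal sets. *)
Definition Insert (tst dec ir : prog) : prog :=
  Close (Call tst [:: Var 0; Seq (Var 1) (Prim Fst); Var 6])
    (Fork (Fork (Var 0) (Seq (Var 1) (Prim Fst)))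
       (Call (Step dec ir)
          [:: Var 0; Seq (Var 1) (Prim Fst); Seq (Var 1) (Prim Snd); Var 6])).

(** The base is tested for [P] first; on failure the output is empty. Otherwise the vertex lists
    found by [Insert] are turned into graph codes at the end. *)
Definition Enumerate (bas tst dec ir : prog) : prog :=
  Seq (Fork Skip (Fork bas (Prim (Const 0))))
    (If (Call (Decide_induced dec) [:: Var 0; Var 1])
       (Fold
          (Seq (Call (Insert tst dec ir)
                  [:: GV 0; Fork (Var 1) (Fork (Var 1) (Prim (Const 0))); Var 0])
             (Prim Snd))
          (Prim (Const 0))
          (Fork (Call Induced [:: Var 2; Var 0]) (Var 1)))
       (Prim (Const 0))).

Definition Tinsert (T T' T'' : nat -> nat) (K N : nat) : nat :=
  N * (N * (2 * (T'' N + Tstep T T' K N + 60) + 30) + 60) + 30.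

Definition Tenum (T T' T'' : nat -> nat) (K N : nat) : nat :=
  Tind N + T N + Tinsert T T' T'' K N + K * (Tind N + 100) + 200.

Lemma ev_insert P dec ir T T' G d N vs adm base tst T'' K :
  decides P dec T -> solves_restricted P ir T' -> codes d G -> nverts G <= N ->
  augmentable (family P G) -> insertion_order P G adm base ->
  (forall s w, grown adm (verts G) base s -> w \in verts G ->
    exists2 b, truthy b <-> adm s w &
    ev tst (code_seq [:: Leaf w; code_nats s; d]) b (T'' N)) ->
  uniq vs -> vs =i verts G -> family P G (fs base) ->
  (forall s Hs, grown adm (verts G) base s ->
     enumerates Hs (maxi (family P G) (fs s)) -> size Hs <= K) ->
  exists s Hs, enumerates Hs (maxi (family P G) (verts G)) /\
    ev (Insert tst dec ir)
      (code_seq [:: code_nats vs; Node (code_nats base) (code_sets [:: base]); d])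
      (Node (code_nats s) (code_sets Hs)) (Tinsert T T' T'' K N).
Proof.
move=> decP irP dG leN aug ord tstP uvs evs_ Fb leK.
have [ub admN rem stuck _] := ord.
pose cx (s : seq nat * seq (seq nat)) := Node (code_nats s.1) (code_sets s.2).
pose Inv (s : seq nat * seq (seq nat)) := grown adm (verts G) base s.1 /\
  enumerates s.2 (maxi (family P G) (fs s.1)).
have levs : size vs <= N.
  by apply: (size_le_nverts uvs _ leN) => x; rewrite evs_.
have [] := @ev_close _ cx fst (fun s => adm s.1) Inv vs (base, [:: base]) (code_seq [:: d])
  (Call tst [:: Var 0; Seq (Var 1) (Prim Fst); Var 6])
  (Fork (Fork (Var 0) (Seq (Var 1) (Prim Fst)))
       (Call (Step dec ir)
          [:: Var 0; Seq (Var 1) (Prim Fst); Seq (Var 1) (Prim Snd); Var 6]))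
  N (T'' N + Tstep T T' K N + 60) levs.
- split; first exact: grown_base.
  (* The base is itself in the family, so it is the only maximal set of the initial prefix. *)
  split=> //=; first by rewrite ub.1.
  move=> S; rewrite inE; split=> [/eqP->|[FS SU mS]].
    split=> // U _ bU Ub; apply/eqP; by rewrite eqEfsubset Ub bU.
  by apply/eqP/esym/mS.
- move=> [s Hs] [gs _]; have [us ss] := grown_sub ord gs.
  by split=> // x /ss; rewrite evs_.
- by move=> [s Hs] w /admN.
- move=> w [s Hs] x1 x2 x3 x4; rewrite evs_ => wV [gs _].
  have [b bP evb] := tstP _ _ gs wV.
  exists b => //; eapply ev_le; first by eapply ev_call3; [evs|evs|evs|exact: evb].
  by clear; lia.
- move=> w [s Hs] x1 x2 x3 x4; rewrite evs_ => wV [gs eHs] aw.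
  have [us ss] := grown_sub ord gs.
  (* Choice turns the existence of greedy extensions into a function; lists outside its domain are
     sent to the empty list. *)
  have [g gP] : exists g : seq nat -> seq nat, forall S,
      [/\ uniq S, {subset S <= s} & family P G (fs S)] ->
      greedy_spec P G d dec T N s S (g S).
    suff /choice[g gP] : forall S, exists S', [/\ uniq S, {subset S <= s} &
        family P G (fs S)] -> greedy_spec P G d dec T N s S S' by exists g.
    move=> S.
    have [[uS sS FS]|no] := pselect [/\ uniq S, {subset S <= s} & family P G (fs S)].
      by have [S' ?] := ev_greedy decP aug dG leN us ss uS sS FS; exists S'.
    by exists [::].
  have gP' S : uniq S -> {subset S <= s} -> family P G (fs S) ->
    greedy_spec P G d dec T N s S (g S) by move=> *; apply: gP.
  have [Hs' eHs' evS] := ev_step decP irP dG leN aug wV (admN _ _ aw) us ss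
    (rem _ _ gs wV aw) gP' eHs (leK _ _ gs eHs).
  exists (w :: s, Hs'); split=> //.
    by split; [apply: grown_cons | rewrite fs_cons].
  eapply ev_le.
    apply: ev_fork; first by evs.
    by eapply ev_call4; [evs|evs|evs|evs|exact: evS].
  by clear; lia.
move=> [s Hs] [[gs eHs] sat evI]; exists s, Hs; split=> //.
suff <- : fs s = verts G by [].
have [us ss] := grown_sub ord gs.
apply/eqP; rewrite eqEfsubset; apply/andP; split; first exact/fs_sub.
apply/fsubsetP => x xV; rewrite in_fs; apply: (stuck s gs) => // w wV.
by apply: sat; rewrite evs_.
Qed.

Lemma ev_enumerate P bas dec ir T T' G d N adm base tst T'' :
  decides P dec T -> solves_restricted P ir T' -> codes d G -> nverts G <= N ->
  augmentable (family P G) -> insertion_order P G adm base ->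
  (forall s w, grown adm (verts G) base s -> w \in verts G ->
    exists2 b, truthy b <-> adm s w &
    ev tst (code_seq [:: Leaf w; code_nats s; d]) b (T'' N)) ->
  ev bas d (code_nats base) 10 ->
  exists out K, lists out (maximal_P_subgraph P G) K /\
    ev (Enumerate bas tst dec ir) d out (Tenum T T' T'' K N).
Proof.
move=> decP irP dG leN aug ord tstP evbas.
have [ub admN rem stuck Fbase] := ord.
have ev0 : ev (Fork Skip (Fork bas (Prim (Const 0)))) d
    (code_seq [:: d; code_nats base]) 20.
  eapply ev_le; first by apply: ev_fork; [evs | apply: ev_fork; [exact: evbas | evs]].
  by clear; lia.
have [b bP evb] := ev_decide_induced decP dG ub.1 ub.2 leN.
have ev1 : ev (Call (Decide_induced dec) [:: Var 0; Var 1])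
    (code_seq [:: d; code_nats base]) b (Tind N + T N + 20).
  eapply ev_le; first by eapply ev_call2; [evs|evs|exact: evb].
  by clear; lia.
have maxE X : maximal_P_subgraph P G X <->
    exists2 S, maxi (family P G) (verts G) S & X = induced G S.
  by have := @maximal_P_subgraphE P G (verts G) X (fsubset_refl _); rewrite induced_verts.
have [tb|ntb] := boolP (truthy b); last first.
  (* Any P-subset would put the base into the family, so a failed test means that there is nothing
     to output. *)
  exists (code_seq [::]), 0; split.
    exists [::], [::]; split=> // X; split=> // /maxE[S [FS _ _] _].
    by case/negP: ntb; apply/bP; case: (Fbase _ FS).
  eapply ev_le.
    apply: (ev_seq ev0); apply: (ev_if (B := 0) ev1); first by rewrite (negPf ntb).
    by move=> _; evs.
  by rewrite /Tenum; clear; lia.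
have Fb : family P G (fs base).
  by split; [apply/fs_sub; case: ub | apply/bP].
have [Ks eKs] := @enumerates_exists (verts G) (maxi (family P G) (verts G))
  (fun S mS => let: And3 _ s _ := mS in s).
have [vs [es [uvs evs_ _ _ ed]]] := dG.
have [|s [Hs [eHs evI]]] := @ev_insert P dec ir T T' G d N vs adm base tst T'' (size Ks)
  decP irP dG leN aug ord tstP uvs evs_ Fb.
  by move=> s Hs gs eHs; apply: enumerates_grown_le gs eHs eKs.
have evG : ev (GV 0) (code_seq [:: d; code_nats base]) (code_nats vs) 3.
  by eapply ev_le; [rewrite /GV ed; evs|].
have sHs : size Hs = size Ks := enumerates_size eHs eKs.
have [aHs uHs HsP] := eHs.
have HsV S : S \in map fs Hs -> (S `<=` verts G)%fset by case/HsP.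
have [] := @ev_fold (seq data) (seq nat) code_nats code_seq
  (fun p acc => List.Forall2 codes acc [seq induced G (fs H) | H <- rev p])
  (code_seq [:: d; code_nats base])
  (Seq (Call (Insert tst dec ir)
                  [:: GV 0; Fork (Var 1) (Fork (Var 1) (Prim (Const 0))); Var 0])
             (Prim Snd))
  (Prim (Const 0)) (Fork (Call Induced [:: Var 2; Var 0]) (Var 1))
  Hs [::] (size Ks) (Tind N + 30) (Tinsert T T' T'' (size Ks) N + 50) 1.
- eapply ev_le.
    apply: (ev_seq (y := Node (code_nats s) (code_sets Hs))); last by evs.
    eapply ev_call3; [exact: evG|evs|evs|exact: evI].
  by clear; lia.
- by evs.
- by rewrite sHs.
- by [].
- move=> p H q acc eH IH.
  have uH : uniq H by move: aHs; rewrite eH all_cat /= => /and3P[].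
  have sH : {subset H <= verts G}.
    by apply/fs_sub/HsV; rewrite eH map_cat mem_cat /= mem_head orbT.
  have [es' [ues' ees' evH]] := ev_induced dG uH sH leN.
  exists (graph_code H es' (groot (induced G (fs H))) :: acc).
    by rewrite rev_rcons /=; constructor=> //; apply: codes_graph_code.
  eapply ev_le.
    apply: ev_fork; last by evs.
    by eapply ev_call2; [evs|evs|exact: evH].
  by clear; lia.
move=> ds dsP evds; exists (code_seq ds), (size Ks); split.
  exists ds, [seq induced G (fs H) | H <- rev Hs]; split=> //.
  - rewrite map_rev rev_uniq (map_comp (induced G) fs) map_inj_in_uniq //.
    move=> S1 S2 /HsV S1V /HsV S2V /(congr1 verts).
    by rewrite !verts_induced_sub.
  - move=> X; split=> [/mapP[H]|/maxE[S /HsP/mapP[H HHs ->] ->]].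
      rewrite mem_rev => HHs ->; apply/maxE; exists (fs H) => //.
      by apply/HsP/map_f.
    by apply/mapP; exists H; rewrite ?mem_rev.
  - by rewrite size_map size_rev.
eapply ev_le.
  apply: (ev_seq ev0); apply: (ev_if (C := 0) ev1); first by move=> _; exact: evds.
  by rewrite tb.
by rewrite /Tenum; clear; lia.
Qed.

(** * Insertion orders *)

Section Reach.

Variable T : eqType.
Implicit Types (e : rel T) (u v x : T) (p : seq T).

Definition reach e u v : Prop := exists2 p, path e u p & last u p = v.

Lemma reach_refl e u : reach e u u.
Proof. by exists [::]. Qed.

Lemma reach_trans e v u x : reach e u v -> reach e v x -> reach e u x.
Proof.
move=> [p ep <-] [q eq <-]; exists (p ++ q); last by rewrite last_cat.
by rewrite cat_path ep.
Qed.

Lemma reach1 e u v : e u v -> reach e u v.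
Proof. by move=> euv; exists [:: v] => //=; rewrite euv. Qed.

Lemma reach_mono e e' u v : subrel e e' -> reach e u v -> reach e' u v.
Proof. by move=> ee' [p ep <-]; exists p => //; apply: sub_path ep. Qed.

Lemma reach_sym e u v : symmetric e -> reach e u v -> reach e v u.
Proof.
move=> se [p ep <-]; elim: p u ep => [|x p IH] u /=; first by move=> _; apply: reach_refl.
case/andP=> eux /IH rx; apply: reach_trans rx _.
by apply: reach1; rewrite se.
Qed.

Lemma reach_exit e (A : pred T) u v : reach e u v -> A u -> ~~ A v ->
  exists x y, [/\ A x, ~~ A y & e x y].
Proof.
move=> [p ep <-]; elim: p u ep => [|x p IH] u /=; first by move=> _ ->.
case/andP=> eux ep Au nAv; have [Ax|nAx] := boolP (A x); first exact: IH ep Ax nAv.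
by exists u, x.
Qed.

Lemma reach_uniq e u v : reach e u v ->
  exists p, [/\ path e u p, last u p = v & uniq (u :: p)].
Proof. by case=> p ep <-; case/shortenP: ep => q eq uq _; exists q. Qed.

Lemma path_cycle e x p : path e x p -> ~~ uniq (x :: p) ->
  exists2 c, c != [::] & cycle e c.
Proof.
elim: p x => // y p IH x ep; rewrite cons_uniq negb_and negbK.
case/orP=> [xp|nu]; last by case/andP: ep => _ /IH; apply.
case/splitPr: xp ep => p1 p2; rewrite cat_path => /andP[ep1 /= /andP[ex _]].
by exists (x :: p1) => //=; rewrite rcons_path ep1.
Qed.

End Reach.

Section Hereditary.

Variables (P : graph -> Prop) (G : graph).

Notation F := (family P G).

Local Open Scope fset_scope.

Lemma edge_induced S u v :
  edge (induced G S) u v = [&& edge G u v, u \in S & v \in S].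
Proof. by rewrite /edge in_induced_edges. Qed.

Lemma adj_induced S u v :
  adj (induced G S) u v = [&& adj G u v, u \in S & v \in S].
Proof.
rewrite /adj !edge_induced; case: (u \in S); case: (v \in S);
  by rewrite ?andbT ?andbF.
Qed.

Lemma adj_sym : symmetric (adj G).
Proof. by move=> u v; rewrite /adj orbC. Qed.

Lemma adj_verts u v : adj G u v -> (u \in verts G) /\ (v \in verts G).
Proof. by case/orP=> /edge_verts []. Qed.

Lemma edge_induced_sub S S' : S `<=` S' ->
  subrel (edge (induced G S)) (edge (induced G S')).
Proof.
move=> /fsubsetP sS u v; rewrite !edge_induced => /and3P[-> uS vS] /=.
by rewrite !sS.
Qed.

Lemma adj_induced_sub S S' : S `<=` S' ->
  subrel (adj (induced G S)) (adj (induced G S')).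
Proof.
move=> /fsubsetP sS u v; rewrite !adj_induced => /and3P[-> uS vS] /=.
by rewrite !sS.
Qed.

Lemma path_all_induced S u p : path (adj (induced G S)) u p -> u \in S ->
  all [in S] (u :: p).
Proof.
elim: p u => [|x p IH] u /=; first by move=> _ ->.
rewrite adj_induced => /andP[/and3P[_ _ xS] ep] uS.
by rewrite uS /=; apply: IH.
Qed.

(** * Rooted-hereditary properties on acyclic graphs *)

Section Rooted.

Hypothesis hP : rooted_hereditary P.

Lemma rooted_inducedP S : S `<=` verts G ->
  rooted (induced G S) <->
  exists r, [/\ groot G = Some r, r \in S &
    forall v, v \in S -> reach (edge (induced G S)) r v].
Proof.
move=> SV; rewrite /rooted groot_induced verts_induced_sub //; split.
  case=> r; case: (groot G) => [x|] //; case: ifP => // xS [<-] rv.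
  by exists x.
by case=> r [-> rS rv]; exists r; rewrite ?rS.
Qed.

Lemma family_rooted S : F S -> exists r, [/\ groot G = Some r, r \in S &
  forall v, v \in S -> reach (edge (induced G S)) r v].
Proof. by case=> SV /hP.1 /rooted_inducedP; apply. Qed.

Lemma family_sub_rooted S S' : F S -> S' `<=` S ->
  (exists r, [/\ groot G = Some r, r \in S' &
    forall v, v \in S' -> reach (edge (induced G S')) r v]) -> F S'.
Proof.
move=> [SV PS] S'S rS'; have S'V := fsubset_trans S'S SV.
split=> //; apply: (hP.2 _ _ PS); first exact/sub_IS_induced.
exact/rooted_inducedP.
Qed.

(** A path from the common root to a vertex of [S'] outside [S] leaves [S] along an edge inside
    [S']. The head of this edge can be added, as it is reached through [S]. *)
Lemma rooted_augmentable : augmentable F.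
Proof.
move=> S S' FS FS' /[dup] /fproper_sub SS'; rewrite fproperE => /andP[_ /fsubsetPn[x xS' xS]].
have [r [er rS rv]] := family_rooted FS.
have [r' [er' _ rv']] := family_rooted FS'.
have e : r' = r by move: er'; rewrite er => -[].
subst r'; have [u [w [uS wS]]] := reach_exit (rv' x xS') (A := [in S]) rS xS.
rewrite edge_induced => /and3P[euw _ wS']; exists w; split=> //.
apply: (family_sub_rooted FS').
  by apply/fsubsetP => y; rewrite !inE => /orP[/eqP->|/(fsubsetP SS')].
have sub : S `<=` w |` S by apply: fsubsetU1.
exists r; split=> //; first by rewrite !inE rS orbT.
have rS1 v : v \in S -> reach (edge (induced G (w |` S))) r v.
  by move/rv; apply: reach_mono; apply: edge_induced_sub.
move=> v; rewrite !inE => /orP[/eqP->|/rS1//].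
apply: reach_trans (rS1 u uS) _; apply: reach1.
by rewrite edge_induced euw !inE eqxx uS orbT.
Qed.

Definition topo_adm (s : seq nat) (w : nat) : Prop :=
  w \notin s /\ forall u, edge G u w -> u \in s.

Definition root_seq : seq nat := if groot G is Some r then [:: r] else [::].

(** The order is topological except that the root comes first: an edge from outside the prefix into
    it can only enter the root. *)
Lemma grown_topo s : grown topo_adm (verts G) root_seq s ->
  {subset root_seq <= s} /\
  forall w u, w \notin s -> u \in s -> edge G w u -> u \in root_seq.
Proof.
elim=> [|{}s w' _ [sub IH] w'V [w's predw']]; split=> //.
  by move=> x /sub; rewrite inE orbC => ->.
move=> w u; rewrite !inE negb_or => /andP[nww' nws] /orP[/eqP->|us] ewu.
  by rewrite predw' in nws.
exact: IH ewu.
Qed.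

(** A simple path from the root that passes through [w] would continue to a vertex of the prefix,
    necessarily the root, where the path began. So simple paths to other vertices avoid [w]. *)
Lemma topo_removable s w : grown topo_adm (verts G) root_seq s ->
  topo_adm s w -> removable F w (fs s).
Proof.
move=> gs [nws predw] S FS Ssw; have [sub noback] := grown_topo gs.
have [r [er rS rv]] := family_rooted FS.
have rw : r != w.
  by apply: contra nws => /eqP<-; apply: sub; rewrite /root_seq er mem_head.
apply: (family_sub_rooted FS); first exact: fsubD1set.
exists r; split=> //; first by rewrite !inE rw.
move=> v; rewrite !inE => /andP[vw vS].
have [p [ep lp up]] := reach_uniq (rv v vS).
have wp : w \notin r :: p.
  rewrite inE negb_or eq_sym rw /=; apply/negP => wp.
  case/splitPr: wp ep lp up => p1 [|x p2].
    by rewrite last_cat /= => _ ew; rewrite ew eqxx in vw.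
  rewrite cat_path /= !edge_induced => /and4P[_ _ /and3P[ewx _ xS] _] _.
  case/andP=> rp up.
  have : x \in root_seq.
    apply: noback ewx => //; have := fsubsetP Ssw _ xS.
    rewrite !inE => /orP[/eqP xw|//]; move: up; rewrite xw cat_uniq /=.
    by rewrite inE eqxx /= !andbF.
  rewrite /root_seq er inE => /eqP xr; move: rp.
  by rewrite xr mem_cat !inE eqxx !orbT.
exists p => //; apply: (sub_in_path (P := predC1 w) _ _ ep).
  move=> a b; rewrite !inE => aw bw; rewrite !edge_induced !inE aw bw.
  by [].
by apply/allP => a ap; apply: contra wp => /eqP <-.
Qed.

Lemma topo_stuck s : acyclic G ->
  (forall w, w \in verts G -> ~ topo_adm s w) -> {subset verts G <= s}.
Proof.
move=> acG stuck x xV; apply: contraT => nxs.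
have walk n : exists y p, [/\ path (edge G) y p, size p = n,
    y \in verts G, y \notin s & {subset y :: p <= verts G}].
  elim: n => [|n [y [p [ep sp yV nys sub]]]].
    by exists x, [::]; split=> // z; rewrite inE => /eqP->.
  have [u euy nus] : exists2 u, edge G u y & u \notin s.
    apply: contrapT => nex; apply: (stuck y yV); split=> // u euy.
    by apply: contraT => nus; case: nex; exists u.
  have [uV _] := edge_verts euy.
  exists u, (y :: p); split=> //=; [by rewrite euy | by rewrite sp |].
  by move=> z; rewrite inE => /orP[/eqP->|/sub].
have [y [p [ep sp _ _ sub]]] := walk (nverts G).
have [|c cn cc] := path_cycle ep; last by have := acG c cn; rewrite cc.
apply/negP => u; have := size_le_nverts u sub (leqnn _).
by rewrite /= sp ltnn.
Qed.

Lemma topo_insertion_order : acyclic G -> insertion_order P G topo_adm root_seq.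
Proof.
move=> acG; split.
- rewrite /root_seq; case er: (groot G) => [r|] //; split=> // x.
  by rewrite inE => /eqP->; apply: groot_verts.
- by move=> s w [].
- by move=> s w gs _; apply: topo_removable.
- by move=> s _; apply: topo_stuck.
move=> S FS; have [r [er rS rv]] := family_rooted FS.
apply: (family_sub_rooted FS).
  by apply/fs_sub => x; rewrite /root_seq er inE => /eqP->.
exists r; split=> //; first by rewrite in_fs /root_seq er mem_head.
move=> v; rewrite in_fs /root_seq er inE => /eqP->; exact: reach_refl.
Qed.

End Rooted.

(** * Connected-hereditary properties on trees *)

Section Tree.

Hypothesis hP : connected_hereditary P.

Lemma family_sub_connected S S' : F S -> S' `<=` S ->
  connected (induced G S') -> F S'.
Proof.
move=> [SV PS] S'S cS'; have S'V := fsubset_trans S'S SV.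
by split=> //; apply: (hP.2 _ _ PS) => //; apply/sub_IS_induced.
Qed.

Lemma connected_reach S : S `<=` verts G -> connected (induced G S) <->
  forall u v, u \in S -> v \in S -> reach (adj (induced G S)) u v.
Proof. by move=> SV; rewrite /connected verts_induced_sub. Qed.

Lemma connected1 w : w \in verts G -> connected (induced G [fset w]).
Proof.
move=> wV; apply/connected_reach; first by rewrite fsub1set.
by move=> u v; rewrite !inE => /eqP-> /eqP->; apply: reach_refl.
Qed.

Lemma connectedU1 S a w : S `<=` verts G -> connected (induced G S) ->
  a \in S -> adj G a w -> connected (induced G (w |` S)).
Proof.
move=> SV /(connected_reach SV) cS aS aw.
have wV := (adj_verts aw).2.
have sub : S `<=` w |` S by apply: fsubsetU1.
have symS : symmetric (adj (induced G (w |` S))).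
  by move=> u v; rewrite /adj orbC.
have toa u : u \in w |` S -> reach (adj (induced G (w |` S))) u a.
  rewrite !inE => /orP[/eqP->|uS].
    by apply: reach1; rewrite adj_induced adj_sym aw !inE eqxx aS orbT.
  by apply: reach_mono (cS u a uS aS); apply: adj_induced_sub.
apply/connected_reach; first by rewrite fsubUset fsub1set wV.
move=> u v /toa ua /toa va; apply: reach_trans ua _.
exact: reach_sym.
Qed.

(** A path inside [S'] that leaves [S] supplies the new vertex. The empty set offers no start for
    such a path, and there any vertex of [S'] will do. *)
Lemma connected_augmentable : augmentable F.
Proof.
move=> S S' FS FS' /[dup] /fproper_sub SS'; rewrite fproperE => /andP[_ /fsubsetPn[x xS' xS]].
have [SV PS] := FS; have [S'V PS'] := FS'.
have sub w : w \in S' -> w |` S `<=` S'.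
  move=> wS'; apply/fsubsetP => y; rewrite !inE.
  by case/orP=> [/eqP->|/(fsubsetP SS')].
have [S0|/fset0Pn[u uS]] := eqVneq S fset0.
  exists x; split=> //; apply: (family_sub_connected FS'); first exact: sub.
  rewrite S0 fsetU0; apply: connected1; exact: (fsubsetP S'V).
have r := (connected_reach S'V).1 (hP.1 _ PS') u x (fsubsetP SS' _ uS) xS'.
have [a [w [aS wS]]] := reach_exit r (A := [in S]) uS xS.
rewrite adj_induced => /and3P[aw _ wS']; exists w; split=> //.
apply: (family_sub_connected FS'); first exact: sub.
exact: (connectedU1 SV (hP.1 _ PS) aS aw).
Qed.

Definition tree_adm (s : seq nat) (w : nat) : Prop :=
  w \notin s /\ (s = [::] \/ exists2 u, u \in s & adj G u w).

Lemma grown_tree s : grown tree_adm (verts G) [::] s ->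
  {subset s <= verts G} /\ connected (induced G (fs s)).
Proof.
elim=> [|{}s w _ [sV cs] wV [nws att]].
  by split=> // u v; rewrite verts_induced !inE andbF.
split; first by move=> x; rewrite inE => /orP[/eqP->|/sV].
rewrite fs_cons; case: att => [->|[u us uw]].
  have -> : w |` fs [::] = [fset w] by apply/fsetP => x; rewrite !inE orbF.
  exact: connected1.
by apply: (connectedU1 _ cs _ uw); [apply/fs_sub | rewrite in_fs].
Qed.

(* Two neighbours of [w] among the vertices inserted before it would close a
   cycle, so [w] is a leaf when it is inserted. *)
Lemma tree_removable s w : underlying_tree G ->
  grown tree_adm (verts G) [::] s -> tree_adm s w -> removable F w (fs s).
Proof.
move=> [_ _ noc] gs [nws _] S FS Ssw; have [sV cs] := grown_tree gs.
have fsV : fs s `<=` verts G by apply/fs_sub.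
have [SV PS] := FS.
have in_s x : x \in S -> x != w -> x \in s.
  by move=> /(fsubsetP Ssw); rewrite !inE => /orP[->|].
apply: (family_sub_connected FS); first exact: fsubD1set.
apply/connected_reach; first exact: fsubset_trans (fsubD1set _ _) SV.
move=> u v; rewrite !inE => /andP[uw uS] /andP[vw vS].
have [p [ep lp up]] := reach_uniq ((connected_reach SV).1 (hP.1 _ PS) u v uS vS).
have wp : w \notin u :: p.
  rewrite inE negb_or eq_sym uw /=; apply/negP => wp.
  case/splitPr: wp ep lp up => p1 [|b p2].
    by rewrite last_cat /= => _ ew; rewrite ew eqxx in vw.
  rewrite cat_path /= !adj_induced => /and4P[ep1 /and3P[aw aS _] /and3P[wb _ bS] _] _ up.
  set a := last u p1 in aw aS.
  move: (up : uniq ((u :: p1) ++ [:: w, b & p2])); rewrite cat_uniq => /and3P[_ /hasPn disj /= /andP[wn _]].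
  have ap1 : a \in u :: p1 by apply: mem_last.
  have nab : a != b.
    by apply: contraTneq ap1 => ->; apply: disj; rewrite !inE eqxx orbT.
  have naw : a != w by apply: contraTneq ap1 => ->; apply: disj; rewrite mem_head.
  have nbw : b != w by apply: contraNneq wn => <-; rewrite mem_head.
  have as_ := in_s a aS naw; have bs := in_s b bS nbw.
  (* The neighbours [a] and [b] of [w] on the path are joined by a simple path inside the prefix,
     which avoids [w]. Together with [w] it forms a cycle, of length at least three because [a]
     differs from [b]. *)
  have [||q [eq lq uq]] := reach_uniq ((connected_reach fsV).1 cs a b _ _).
  - by rewrite in_fs.
  - by rewrite in_fs.
  have qs : all [in fs s] (a :: q) by apply: (path_all_induced eq); rewrite in_fs.
  apply: (noc [:: w, a & q]).
    by case: q lq {eq uq qs} => //= ab; rewrite ab eqxx in nab.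
  rewrite /ucycle cons_uniq uq andbT; apply/andP; split.
    rewrite /= rcons_path adj_sym aw lq adj_sym wb andbT.
    apply: sub_path eq => x y; rewrite adj_induced; by case/andP.
  by apply: contra nws => /(allP qs); rewrite /= in_fs.
exists p => //; apply: (sub_in_path (P := predC1 w) _ _ ep).
  by move=> a b; rewrite !inE => aw bw; rewrite !adj_induced !inE aw bw.
by apply/allP => a ap; apply: contra wp => /eqP <-.
Qed.

Lemma tree_stuck s : connected G -> {subset s <= verts G} ->
  (forall w, w \in verts G -> ~ tree_adm s w) -> {subset verts G <= s}.
Proof.
move=> cG sV stuck x xV; apply: contraT => nxs; case: s sV stuck nxs => [|u s] sV stuck nxs.
  by case: (stuck x xV); split=> //; left.
have r : reach (adj G) u x by apply: cG => //; apply: sV; rewrite mem_head.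
have [a [w [aS wS aw]]] := reach_exit r (A := [in u :: s]) (mem_head _ _) nxs.
by case: (stuck w (adj_verts aw).2); split=> //; right; exists a.
Qed.

Lemma tree_insertion_order : underlying_tree G -> insertion_order P G tree_adm [::].
Proof.
move=> tG; have [cG _ _] := tG; split=> //.
- by move=> s w [].
- by move=> s w gs _; apply: tree_removable.
- by move=> s gs; apply: tree_stuck => //; case: (grown_tree gs).
(* The empty graph counts as connected, so it is a P-subgraph as soon as there is any. *)
move=> S FS; apply: (family_sub_connected FS); first by apply/fs_sub.
by move=> u v; rewrite verts_induced !inE andbF.
Qed.

End Tree.

End Hereditary.

(** * Order tests and polynomial bounds *)

Lemma size_codes_edges G (es : seq (nat * nat)) N :
  uniq es -> es =i edges G -> nverts G <= N -> size es <= N * N.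
Proof.
by move=> ues ees leN; apply: leq_trans (size_edges ues ees) _; apply: leq_mul.
Qed.

(* Both order tests have the environment [w; proc; graph]. *)
Definition Topo_test : prog :=
  If (Call Mem [:: Var 0; Var 1]) (Prim (Const 0))
    (Fold (GE 2) (Prim (Const 1))
       (If (Neq (Seq (Var 0) (Prim Snd)) (Var 2)) (Var 1)
          (If (Call Mem [:: Seq (Var 0) (Prim Fst); Var 3]) (Var 1)
             (Prim (Const 0))))).

Definition Tree_test : prog :=
  If (Call Mem [:: Var 0; Var 1]) (Prim (Const 0))
    (If (Var 1)
       (Fold (GE 2) (Prim (Const 0))
          (If (Neq (Seq (Var 0) (Prim Fst)) (Var 2))
             (If (Neq (Seq (Var 0) (Prim Snd)) (Var 2)) (Var 1)
                (If (Call Mem [:: Seq (Var 0) (Prim Fst); Var 3])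
                   (Prim (Const 1)) (Var 1)))
             (If (Call Mem [:: Seq (Var 0) (Prim Snd); Var 3])
                (Prim (Const 1)) (Var 1))))
       (Prim (Const 1))).

Definition Ttest (N : nat) : nat := Tmem N + N * N * (2 * Tmem N + 150) + 150.

Lemma ev_topo_test d G s w N : codes d G -> nverts G <= N -> size s <= N ->
  exists2 b, truthy b <-> topo_adm G s w &
    ev Topo_test (code_seq [:: Leaf w; code_nats s; d]) b (Ttest N).
Proof.
move=> [vs [es [_ _ ues ees ->]]] leN les; rewrite -/(code_nats vs) -/(graph_code vs es (groot G)).
have leE := size_codes_edges ues ees leN.
pose pe (e : nat * nat) := (e.2 != w) || (e.1 \in s).
have [] := @ev_fold bool _ code_edge code_bool (fun p b => b = all pe p)
  (code_seq [:: Leaf w; code_nats s; graph_code vs es (groot G)])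
  (GE 2) (Prim (Const 1))
  (If (Neq (Seq (Var 0) (Prim Snd)) (Var 2)) (Var 1)
     (If (Call Mem [:: Seq (Var 0) (Prim Fst); Var 3]) (Var 1) (Prim (Const 0))))
  es true (N * N) (Tmem N + 60) 10 1.
- by eapply ev_le; [rewrite /GE; evs|].
- by evs.
- by [].
- by [].
- move=> p e q _ _ ->; exists (all pe (rcons p e)) => //; rewrite all_rcons /pe.
  eapply ev_le.
    apply: ev_if; first by eapply ev_neq; evs.
      by rewrite truthy_neq => -> /=; evs.
    rewrite truthy_neq negbK => /eqP ->; rewrite eqxx /=.
    apply: ev_if; first by eapply ev_call2; [evs|evs|exact: (ev_mem e.1 les)].
      by rewrite truthy_bool => -> /=; evs.
    by rewrite truthy_bool => /negPf -> /=; evs.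
  by clear; lia.
move=> _ -> evE.
have mem1 : ev (Call Mem [:: Var 0; Var 1])
    (code_seq [:: Leaf w; code_nats s; graph_code vs es (groot G)])
    (code_bool (w \in s)) (Tmem N + 10).
  by eapply ev_le; [eapply ev_call2; [evs|evs|exact: (ev_mem w les)] | clear; lia].
have [ws|nws] := boolP (w \in s).
  exists (Leaf 0); first by split=> // -[]; rewrite ws.
  eapply ev_le.
    apply: (ev_if (C := 0) mem1); first by move=> _; evs.
    by rewrite ws.
  by rewrite /Ttest; clear; lia.
exists (code_bool (all pe es)); last first.
  eapply ev_le.
    apply: (ev_if (B := 0) mem1); first by rewrite truthy_bool (negPf nws).
    by move=> _; exact: evE.
  by rewrite /Ttest; clear; lia.
rewrite truthy_bool; split=> [/allP al|[_ pr]].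
  split=> // u; rewrite /edge -ees => /al; by rewrite /pe /= eqxx.
apply/allP => -[u v]; rewrite ees /pe /=; case: eqP => [->|] //= uw.
exact: pr.
Qed.

Lemma truthy_nats s : truthy (code_nats s) = (s != [::]).
Proof. by case: s. Qed.

Lemma ev_tree_test d G s w N : codes d G -> nverts G <= N -> size s <= N ->
  exists2 b, truthy b <-> tree_adm G s w &
    ev Tree_test (code_seq [:: Leaf w; code_nats s; d]) b (Ttest N).
Proof.
move=> [vs [es [_ _ ues ees ->]]] leN les; rewrite -/(code_nats vs) -/(graph_code vs es (groot G)).
have leE := size_codes_edges ues ees leN.
pose pe (e : nat * nat) := if e.1 == w then e.2 \in s else (e.2 == w) && (e.1 \in s).
have [] := @ev_fold bool _ code_edge code_bool (fun p b => b = has pe p)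
  (code_seq [:: Leaf w; code_nats s; graph_code vs es (groot G)])
  (GE 2) (Prim (Const 0))
  (If (Neq (Seq (Var 0) (Prim Fst)) (Var 2))
     (If (Neq (Seq (Var 0) (Prim Snd)) (Var 2)) (Var 1)
        (If (Call Mem [:: Seq (Var 0) (Prim Fst); Var 3])
           (Prim (Const 1)) (Var 1)))
     (If (Call Mem [:: Seq (Var 0) (Prim Snd); Var 3])
        (Prim (Const 1)) (Var 1)))
  es false (N * N) (2 * Tmem N + 130) 10 1.
- by eapply ev_le; [rewrite /GE; evs|].
- by evs.
- by [].
- by [].
- move=> p e q _ _ ->; exists (has pe (rcons p e)) => //; rewrite has_rcons /pe.
  eapply ev_le.
    apply: ev_if; first by eapply ev_neq; evs.
      rewrite truthy_neq => /negPf ->.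
      apply: ev_if; first by eapply ev_neq; evs.
        by rewrite truthy_neq => /negPf -> /=; evs.
      rewrite truthy_neq negbK => /eqP ->; rewrite eqxx /=.
      apply: ev_if; first by eapply ev_call2; [evs|evs|exact: (ev_mem e.1 les)].
        by rewrite truthy_bool => -> /=; evs.
      by rewrite truthy_bool => /negPf -> /=; evs.
    rewrite truthy_neq negbK => ->.
    apply: ev_if; first by eapply ev_call2; [evs|evs|exact: (ev_mem e.2 les)].
      by rewrite truthy_bool => -> /=; evs.
    by rewrite truthy_bool => /negPf -> /=; evs.
  by clear; lia.
move=> _ -> evE.
have mem1 : ev (Call Mem [:: Var 0; Var 1])
    (code_seq [:: Leaf w; code_nats s; graph_code vs es (groot G)])
    (code_bool (w \in s)) (Tmem N + 10).
  by eapply ev_le; [eapply ev_call2; [evs|evs|exact: (ev_mem w les)] | clear; lia].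
have [ws|nws] := boolP (w \in s).
  exists (Leaf 0); first by split=> // -[]; rewrite ws.
  eapply ev_le.
    apply: (ev_if (C := 0) mem1); first by move=> _; evs.
    by rewrite ws.
  by rewrite /Ttest; clear; lia.
exists (code_bool ((s == [::]) || has pe es)); last first.
  eapply ev_le.
    apply: (ev_if (B := 0) mem1); first by rewrite truthy_bool (negPf nws).
    move=> _; apply: (ev_if (b := code_nats s)); first by evs.
      by rewrite truthy_nats => /negPf ->; exact: evE.
    by rewrite truthy_nats negbK => ->; evs.
  by rewrite /Ttest; clear; lia.
rewrite truthy_bool; split=> [|[_ [->|[u us uw]]]] //.
  case/orP=> [/eqP->|/hasP[[u v]]]; first by split=> //; left.
  rewrite ees /pe /= => uvE; case: eqP uvE => [->|_] uvE.
    by move=> vs'; split=> //; right; exists v; rewrite // /adj /edge uvE orbT.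
  case/andP=> /eqP vw us; split=> //; right; exists u => //.
  by rewrite /adj /edge -vw uvE.
apply/orP; right; apply/hasP; case/orP: uw => [uw|wu].
  exists (u, w); first by rewrite ees.
  by rewrite /pe /= eqxx us; case: eqP us nws => // -> ->.
by exists (w, u); [rewrite ees | rewrite /pe /= eqxx].
Qed.

(** * Polynomial bounds and the factor for the output size *)

Definition polyb (f : nat -> nat) : Prop :=
  exists p : {poly nat}, forall n, f n <= (p.[n])%R.

Lemma polyb_horner (p : {poly nat}) : polyb (fun n => (p.[n])%R).
Proof. by exists p. Qed.

Lemma polyb_const c : polyb (fun=> c).
Proof. by exists (c%:P)%R => n; rewrite hornerC. Qed.

Lemma polyb_id : polyb id.
Proof. by exists ('X)%R => n; rewrite hornerX. Qed.

Lemma polyb_add f g : polyb f -> polyb g -> polyb (fun n => f n + g n).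
Proof.
by move=> [p fp] [q gq]; exists (p + q)%R => n; rewrite hornerD leq_add.
Qed.

Lemma polyb_mul f g : polyb f -> polyb g -> polyb (fun n => f n * g n).
Proof.
by move=> [p fp] [q gq]; exists (p * q)%R => n; rewrite hornerM leq_mul.
Qed.

(** Coefficients are natural numbers, hence monotonicity: a bound at a subgraph may be replaced by
    the bound at the whole input. *)
Lemma horner_nat_le (p : {poly nat}) m n : m <= n -> (p.[m])%R <= (p.[n])%R.
Proof.
move=> le_mn; elim/poly_ind: p => [|p c IH]; first by rewrite !horner0.
by rewrite !hornerMXaddC leq_add2r leq_mul.
Qed.

Lemma scale_const M c : 0 < M -> c <= M * c.
Proof. by move=> M0; rewrite leq_pmull. Qed.

Lemma scale_add M a b a' b' : a <= M * a' -> b <= M * b' -> a + b <= M * (a' + b').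
Proof. by rewrite mulnDr; apply: leq_add. Qed.

Lemma scale_mull M c a a' : a <= M * a' -> c * a <= M * (c * a').
Proof. by rewrite mulnCA; apply: leq_mul. Qed.

(** The total time is affine in [K]: each summand is free of [K] or contains it as one factor.
    Pulling it out leaves a polynomial in [N]; the maximum with 1 absorbs the summands without
    [K]. *)
Lemma Tenum_scale T T' T'' K N :
  Tenum T T' T'' K N <= maxn 1 K * Tenum T T' T'' 1 N.
Proof.
rewrite /Tenum /Tinsert /Tstep; have M0 : 0 < maxn 1 K by rewrite leq_maxl.
have KM a : K * a <= maxn 1 K * (1 * a) by rewrite mul1n leq_mul2r leq_maxr orbT.
by repeat first [ exact: KM | apply: scale_add | exact: scale_const | apply: scale_mull ].
Qed.

Lemma polyb_Tenum T T' T'' : polyb T -> polyb T' -> polyb T'' ->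
  polyb (Tenum T T' T'' 1).
Proof.
move=> pT pT' pT''.
rewrite /Tenum /Tinsert /Tstep /Thead /Taccept /Ncand /Tgreedy /Tind /Tsub /Tmem.
by repeat first [ exact: polyb_id | exact: polyb_const | assumption
  | apply: polyb_add | apply: polyb_mul ].
Qed.

Lemma polyb_Ttest : polyb Ttest.
Proof.
rewrite /Ttest /Tmem.
by repeat first [ exact: polyb_id | exact: polyb_const | assumption
  | apply: polyb_add | apply: polyb_mul ].
Qed.

Lemma decides_poly P : ptime_decidable P ->
  exists dec (p : {poly nat}), decides P dec (fun n => (p.[n])%R).
Proof.
case=> a [p aP]; exists a, p => G d N dG leN.
have [b [t [ra bP le_t]]] := aP G d dG.
by exists b => //; exists t => //; apply: leq_trans le_t (horner_nat_le p leN).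
Qed.

Lemma solves_restricted_poly P : input_restricted_ptime P ->
  exists ir (p : {poly nat}), solves_restricted P ir (fun n => (p.[n])%R).
Proof.
case=> a [p aP]; exists a, p => G d N alm dG leN.
have [out [K [t [ra lo le_t]]]] := aP G d alm dG.
exists out, K; split=> //.
by exists t => //; apply: leq_trans le_t (horner_nat_le p leN).
Qed.

(** Reduces both claims to augmentability, an insertion order, and programs for its base and its
    admissibility test. *)
Lemma P_enumerable_insertion (D P : graph -> Prop) bas tst
    (adm : graph -> seq nat -> nat -> Prop) (base : graph -> seq nat) :
  ptime_decidable P -> input_restricted_ptime P ->
  (forall G, D G -> augmentable (family P G)) ->
  (forall G, D G -> insertion_order P G (adm G) (base G)) ->
  (forall d G s w N, codes d G -> nverts G <= N -> size s <= N ->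
     exists2 b, truthy b <-> adm G s w &
     ev tst (code_seq [:: Leaf w; code_nats s; d]) b (Ttest N)) ->
  (forall G d, codes d G -> ev bas d (code_nats (base G)) 10) ->
  P_enumerable_on D P.
Proof.
move=> /decides_poly[dec [p decP]] /solves_restricted_poly[ir [q irP]] aug ord tstP basP.
have [r rP] := polyb_Tenum (polyb_horner p) (polyb_horner q) polyb_Ttest.
exists (Enumerate bas tst dec ir), r => G d DG dG.
have tstG s w : grown (adm G) (verts G) (base G) s -> w \in verts G ->
    exists2 b, truthy b <-> adm G s w &
    ev tst (code_seq [:: Leaf w; code_nats s; d]) b (Ttest (nverts G)).
  move=> gs _; have [us ss] := grown_sub (ord G DG) gs.
  by apply: (tstP d G s w _ dG (leqnn _)); apply: (size_le_nverts us ss).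
have [out [K [lo [t rt le_t]]]] := ev_enumerate decP irP dG (leqnn _) (aug G DG)
  (ord G DG) tstG (basP G d dG).
exists out, K, t; split=> //; apply: leq_trans le_t _.
apply: leq_trans (Tenum_scale _ _ _ _ _) _.
by rewrite leq_mul2l rP orbT.
Qed.

Theorem theorem7p1 (P : graph -> Prop) (hP : graph_property P)
    (hIR : input_restricted_ptime P) :
  (rooted_hereditary P -> P_enumerable_on acyclic P) /\
  (connected_hereditary P -> P_enumerable_on underlying_tree P).
Proof.
case: hP => _ decP; split=> her.
  apply: (@P_enumerable_insertion acyclic P (Seq (Prim Snd) (Prim Snd)) Topo_test
    topo_adm root_seq) => //.
  - by move=> G _; apply: rooted_augmentable.
  - by move=> G; apply: topo_insertion_order.
  - exact: ev_topo_test.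
  (* The code of the root in the input is already the code of the list [root_seq]. *)
  move=> G d [vs [es [_ _ _ _ ->]]]; eapply ev_le.
    apply: ev_seq; first by evs.
    by apply: ev_prim; rewrite /= /root_seq; case: (groot G).
  by [].
apply: (@P_enumerable_insertion underlying_tree P (Prim (Const 0)) Tree_test
  tree_adm (fun=> [::])) => //.
- by move=> G _; apply: connected_augmentable.
- by move=> G; apply: tree_insertion_order.
- exact: ev_tree_test.
by move=> G d _; eapply ev_le; [evs|].
Qed.
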